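(* Let $q$ be an odd prime power. Then $$(q-1)\left(h(q,z)-\frac{1}{2}h(q^2,z^2)\right)\in z-\frac{z^2}{q}+2z^3\mathbb{Z}_2[[z]].$$
   Context: For a number $Q$, $h(Q,z)=\log f(Q,z)\in\mathbb{Q}[[z]]$, where $f(Q,z)=\sum_{n\geq0}\frac{(-1)^nz^n}{Q^{\binom{n}{2}}(Q;Q)_n}$ and $(Q;Q)_n=\prod_{i=1}^n(1-Q^i)$. $\mathbb{Z}_2$ denotes the $2$-adic integers. *)

(* Defs.v *)
From HB Require Import structures.
From mathcomp Require Import all_boot all_order all_algebra.
From mathcomp Require Import boolp.

Set Implicit Arguments.
Unset Strict Implicit.
Unset Printing Implicit Defensive.

Import Order.TTheory GRing.Theory Num.Theory.
Local Open Scope ring_scope.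

Record fps (R : Type) := Fps { fps_coef :> nat -> R }.

HB.instance Definition _ (R : Type) := gen_eqMixin (fps R).
HB.instance Definition _ (R : Type) := gen_choiceMixin (fps R).

Lemma fpsP (R : Type) (a b : fps R) : (forall n, a n = b n) -> a = b.
Proof. by case: a b => [a] [b] /= /funext ->. Qed.

Section FpsRing.
Variable R : comNzRingType.
Implicit Types a b c : fps R.

Definition fps_zero : fps R := Fps (fun=> 0).
Definition fps_opp a : fps R := Fps (fun n => - a n).
Definition fps_add a b : fps R := Fps (fun n => a n + b n).
Definition fps_one : fps R := Fps (fun n => (n == 0%N)%:R).
Definition fps_mul a b : fps R := Fps (fun n => \sum_(i < n.+1) a i * b (n - i)%N).
Definition fps_scale (r : R) a : fps R := Fps (fun n => r * a n).

Lemma fps_addA : associative fps_add.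
Proof. by move=> a b c; apply: fpsP => n /=; rewrite addrA. Qed.
Lemma fps_addC : commutative fps_add.
Proof. by move=> a b; apply: fpsP => n /=; rewrite addrC. Qed.
Lemma fps_add0 : left_id fps_zero fps_add.
Proof. by move=> a; apply: fpsP => n /=; rewrite add0r. Qed.
Lemma fps_addN : left_inverse fps_zero fps_opp fps_add.
Proof. by move=> a; apply: fpsP => n /=; rewrite addNr. Qed.

HB.instance Definition _ :=
  GRing.isZmodule.Build (fps R) fps_addA fps_addC fps_add0 fps_addN.

Let trunc n a : {poly R} := \poly_(i < n.+1) a i.

Let truncE n a i : (i <= n)%N -> (trunc n a)`_i = a i.
Proof. by move=> le_in; rewrite coef_poly ltnS le_in. Qed.

Let trunc_mul n a b i :
  (i <= n)%N -> (trunc n a * trunc n b)`_i = fps_mul a b i.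
Proof.
move=> le_in; rewrite coefM /=; apply: eq_bigr => j _.
rewrite !truncE ?(leq_trans (leq_subr _ _)) //.
by rewrite (leq_trans _ le_in) // -ltnS.
Qed.

Lemma fps_mulA : associative fps_mul.
Proof.
move=> a b c; apply: fpsP => n.
have -> : fps_mul a (fps_mul b c) n = (trunc n a * (trunc n b * trunc n c))`_n.
  rewrite coefM /=; apply: eq_bigr => j _.
  by rewrite trunc_mul ?leq_subr // truncE // -ltnS.
rewrite mulrA coefM /=; apply: eq_bigr => j _.
by rewrite trunc_mul -1?ltnS // truncE ?leq_subr.
Qed.

Lemma fps_mulC : commutative fps_mul.
Proof. by move=> a b; apply: fpsP => n; rewrite -!(@trunc_mul n) // mulrC. Qed.

Lemma fps_mul1 : left_id fps_one fps_mul.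
Proof.
move=> a; apply: fpsP => n /=.
rewrite big_ord_recl /= mul1r subn0 big1 ?addr0 // => i _.
by rewrite mul0r.
Qed.

Lemma fps_mulDl : left_distributive fps_mul +%R.
Proof.
move=> a b c; apply: fpsP => n /=; rewrite -big_split /=.
by apply: eq_bigr => i _; rewrite mulrDl.
Qed.

Lemma fps_one_neq0 : fps_one != 0.
Proof.
apply/eqP => /(congr1 (fun a : fps R => a 0%N)) /= /eqP.
by rewrite oner_eq0.
Qed.

HB.instance Definition _ := GRing.Zmodule_isComNzRing.Build (fps R)
  fps_mulA fps_mulC fps_mul1 fps_mulDl fps_one_neq0.

Lemma fps_scaleA r s a : fps_scale r (fps_scale s a) = fps_scale (r * s) a.
Proof. by apply: fpsP => n /=; rewrite mulrA. Qed.
Lemma fps_scale1 : left_id 1 fps_scale.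
Proof. by move=> a; apply: fpsP => n /=; rewrite mul1r. Qed.
Lemma fps_scaleDr : right_distributive fps_scale +%R.
Proof. by move=> r a b; apply: fpsP => n /=; rewrite mulrDr. Qed.
Lemma fps_scaleDl a : {morph fps_scale^~ a : r s / r + s}.
Proof. by move=> r s; apply: fpsP => n /=; rewrite mulrDl. Qed.

HB.instance Definition _ := GRing.Zmodule_isLmodule.Build R (fps R)
  fps_scaleA fps_scale1 fps_scaleDr fps_scaleDl.

Definition fpsX : fps R := Fps (fun n => (n == 1%N)%:R).

(* a(z^d), for d > 0 *)
Definition fps_subst_pow (d : nat) a : fps R :=
  Fps (fun n => if (d %| n)%N then a (n %/ d)%N else 0).

End FpsRing.

Arguments fpsX {R}.

Definition fps_map (R S : Type) (phi : R -> S) (a : fps R) : fps S :=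
  Fps (fun n => phi (a n)).

(* log a = \sum_(k >= 1) (-1)^(k-1) (a - 1)^k / k.  This is meaningful for a
   with constant coefficient 1; then (a - 1)^k only has terms of degree at
   least k, so the coefficient of z^n is the finite sum below. *)
Definition fps_log (K : fieldType) (a : fps K) : fps K :=
  Fps (fun n => \sum_(1 <= k < n.+1) (-1) ^+ k.-1 / k%:R * ((a - 1) ^+ k) n).

Definition qpoch (Q : rat) (n : nat) : rat := \prod_(1 <= i < n.+1) (1 - Q ^+ i).

Definition f_series (Q : rat) : fps rat :=
  Fps (fun n => (-1) ^+ n / (Q ^+ 'C(n, 2) * qpoch Q n)).

Definition h_series (Q : rat) : fps rat := fps_log (f_series Q).

(* Z2 is the inverse limit of the rings Z / 2^n: residue2 x n is the representative in [0, 2^n) of the image of x in Z / 2^n;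
   the coherence condition also forces this range. *)
Record Z2 := MkZ2 {
  residue2 :> nat -> nat;
  residue2_coherent : forall n, residue2 n = (residue2 n.+1 %% 2 ^ n)%N }.

HB.instance Definition _ := gen_eqMixin Z2.
HB.instance Definition _ := gen_choiceMixin Z2.

Lemma Z2P (x y : Z2) : (forall n, x n = y n) -> x = y.
Proof.
case: x y => [x xP] [y yP] /= /funext exy; case: _ / exy in yP *.
by congr MkZ2; apply: Prop_irrelevance.
Qed.

Lemma Z2_mod (x : Z2) n : (x n %% 2 ^ n)%N = x n.
Proof. by rewrite (residue2_coherent x n) modn_mod. Qed.

Lemma Z2_coherent (x : Z2) m n : (m <= n)%N -> (x n %% 2 ^ m)%N = x m.
Proof.
move=> /subnK <-; elim: (n - m)%N => [|d IHd]; first exact: Z2_mod.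
rewrite -[RHS]IHd addSn (residue2_coherent x (d + m)) modn_dvdm //.
by rewrite dvdn_exp2l // leq_addl.
Qed.

Lemma modn2_coherent (a b n : nat) :
  a = b %[mod 2 ^ n] -> (a %% 2 ^ n = b %% 2 ^ n.+1 %% 2 ^ n)%N.
Proof. by move=> ->; rewrite modn_dvdm // dvdn_exp2l. Qed.

Lemma Z2_of_nat_coherent (a n : nat) :
  (a %% 2 ^ n = a %% 2 ^ n.+1 %% 2 ^ n)%N.
Proof. exact: modn2_coherent. Qed.

Definition Z2_of_nat (a : nat) : Z2 := MkZ2 (Z2_of_nat_coherent a).

Lemma Z2_add_coherent (x y : Z2) n :
  ((x n + y n) %% 2 ^ n = (x n.+1 + y n.+1) %% 2 ^ n.+1 %% 2 ^ n)%N.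
Proof.
by apply: modn2_coherent; rewrite -[RHS]modnDm -!residue2_coherent.
Qed.

Definition Z2_add (x y : Z2) : Z2 := MkZ2 (Z2_add_coherent x y).

Lemma Z2_mul_coherent (x y : Z2) n :
  ((x n * y n) %% 2 ^ n = (x n.+1 * y n.+1) %% 2 ^ n.+1 %% 2 ^ n)%N.
Proof.
by apply: modn2_coherent; rewrite -[RHS]modnMm -!residue2_coherent.
Qed.

Definition Z2_mul (x y : Z2) : Z2 := MkZ2 (Z2_mul_coherent x y).

Lemma Z2_lt (x : Z2) n : (x n < 2 ^ n)%N.
Proof. by rewrite -(Z2_mod x n) ltn_mod expn_gt0. Qed.

Lemma Z2_opp_coherent (x : Z2) n :
  ((2 ^ n - x n) %% 2 ^ n = (2 ^ n.+1 - x n.+1) %% 2 ^ n.+1 %% 2 ^ n)%N.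
Proof.
apply: modn2_coherent; apply/eqP.
rewrite -(eqn_modDr (x n)) subnK ?(ltnW (Z2_lt _ _)) //.
rewrite {1}(residue2_coherent x n) modnDmr subnK ?(ltnW (Z2_lt _ _)) //.
by rewrite modnn expnS modnMl.
Qed.

Definition Z2_opp (x : Z2) : Z2 := MkZ2 (Z2_opp_coherent x).

Lemma Z2_addA : associative Z2_add.
Proof. by move=> x y z; apply: Z2P => n /=; rewrite modnDmr modnDml addnA. Qed.
Lemma Z2_addC : commutative Z2_add.
Proof. by move=> x y; apply: Z2P => n /=; rewrite addnC. Qed.
Lemma Z2_add0 : left_id (Z2_of_nat 0) Z2_add.
Proof. by move=> x; apply: Z2P => n /=; rewrite mod0n add0n Z2_mod. Qed.
Lemma Z2_addN : left_inverse (Z2_of_nat 0) Z2_opp Z2_add.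
Proof.
move=> x; apply: Z2P => n /=.
by rewrite modnDml subnK ?(ltnW (Z2_lt _ _)) // modnn mod0n.
Qed.

HB.instance Definition _ :=
  GRing.isZmodule.Build Z2 Z2_addA Z2_addC Z2_add0 Z2_addN.

Lemma Z2_mulA : associative Z2_mul.
Proof. by move=> x y z; apply: Z2P => n /=; rewrite modnMmr modnMml mulnA. Qed.
Lemma Z2_mulC : commutative Z2_mul.
Proof. by move=> x y; apply: Z2P => n /=; rewrite mulnC. Qed.
Lemma Z2_mul1 : left_id (Z2_of_nat 1) Z2_mul.
Proof. by move=> x; apply: Z2P => n /=; rewrite modnMml mul1n Z2_mod. Qed.
Lemma Z2_mulDl : left_distributive Z2_mul +%R.
Proof.
by move=> x y z; apply: Z2P => n /=; rewrite modnMml modnDm mulnDl.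
Qed.
Lemma Z2_one_neq0 : Z2_of_nat 1 != 0.
Proof. by apply/eqP => /(congr1 (fun x : Z2 => x 1%N)). Qed.

HB.instance Definition _ := GRing.Zmodule_isComNzRing.Build Z2
  Z2_mulA Z2_mulC Z2_mul1 Z2_mulDl Z2_one_neq0.

Definition Z2_unit : {pred Z2} := fun x => `[< exists y : Z2, y * x = 1 >].

Definition Z2_inv (x : Z2) : Z2 :=
  if pselect (exists y : Z2, y * x = 1) is left ex then projT1 (cid ex) else x.

Lemma Z2_mulV : {in Z2_unit, left_inverse 1 Z2_inv *%R}.
Proof.
move=> x /asboolP ex; rewrite /Z2_inv; case: pselect => // ex'.
exact: projT2 (cid ex').
Qed.

Lemma Z2_unitP (x y : Z2) : y * x = 1 -> Z2_unit x.
Proof. by move=> yx1; apply/asboolP; exists y. Qed.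

Lemma Z2_inv_out : {in [predC Z2_unit], Z2_inv =1 id}.
Proof.
by move=> x /asboolPn nex; rewrite /Z2_inv; case: pselect.
Qed.

HB.instance Definition _ := GRing.ComNzRing_hasMulInverse.Build Z2
  Z2_mulV Z2_unitP Z2_inv_out.

Lemma Z2_integral : GRing.integral_domain_axiom Z2.
Proof.
move=> x y xy0; apply/orP; case: (eqVneq x 0) => [|x_neq0]; [by left | right].
have [n xn_neq0] : exists n, x n != 0%N.
  apply: contrapT => /forallNP x0; case/eqP: x_neq0; apply: Z2P => n /=.
  by rewrite mod0n; apply/eqP/negPn/negP/x0.
apply/eqP/Z2P => m /=; rewrite mod0n.
have dvd_xy : (2 ^ (n + m) %| x (n + m) * y (n + m))%N.
  move/(congr1 (fun t : Z2 => t (n + m)%N)): xy0 => /= xy0.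
  by rewrite /dvdn xy0 mod0n.
have ndvd_x : ~~ (2 ^ n %| x (n + m))%N by rewrite /dvdn Z2_coherent ?leq_addr.
have x_gt0 : (0 < x (n + m))%N.
  by rewrite lt0n; apply: contraNneq ndvd_x => ->.
have [y0|y_gt0] := posnP (y (n + m)%N).
  by rewrite -(Z2_coherent y (leq_addl n m)) y0 mod0n.
apply/eqP; rewrite -(Z2_coherent y (leq_addl n m)) -/(dvdn _ _).
rewrite pfactor_dvdn // in ndvd_x *; rewrite -ltnNge in ndvd_x.
rewrite pfactor_dvdn ?muln_gt0 ?x_gt0 // lognM // in dvd_xy.
rewrite pfactor_dvdn //.
by rewrite -(leq_add2l n) (leq_trans dvd_xy) // leq_add2r ltnW.
Qed.

HB.instance Definition _ := GRing.ComUnitRing_isIntegral.Build Z2 Z2_integral.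

(* Q is regarded as a subfield of Q2 through ratr. *)
Definition Q2 : fieldType := {fraction Z2}.

Definition Z2_to_Q2 (x : Z2) : Q2 := tofrac x.

Definition prime_power (q : nat) : Prop :=
  exists p k : nat, [/\ prime p, (0 < k)%N & q = (p ^ k)%N].

(* Main.v *)
From HB Require Import structures.
Require Import Defs.
From mathcomp Require Import all_boot all_order all_algebra.
From mathcomp Require Import all_solvable all_field.
From mathcomp Require Import boolp ring zify lra.
Import GRing.Theory.
Local Open Scope ring_scope.
Set Implicit Arguments.
Unset Strict Implicit.
Unset Printing Implicit Defensive.

(* Put t = 1/q and F(z) = f(q, z).  Then F(z) = F(tz) + t z F(t^2 z), so
   R(z) = F(z) / F(tz) is the Rogers-Ramanujan continued fraction
   1 + t z / (1 + t^2 z / ...), with coefficients in Z[t].  Writing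
   a_n(t) = n [z^n] log R, one has n (1 - t^n) h_n(q) = a_n(t), so the
   coefficient of z^n in the theorem is governed by the defect
   a_n(t) - a_{n/2}(t^2).  Let n = 2^s r with r odd.
   - Since R(t, z)^2 = R(t^2, z^2) mod 2, a Dwork-type congruence shows that 2^s
     divides the defect in Z[t].
   - If zeta has order N = 2^j, the product P of the R(zeta, zeta^i z), i < N, is
     an eigenvalue of a product of N transfer matrices with determinant -z^N and
     trace 1, so P^2 = P + z^N and P = R(1, z^N).  Hence
     a_n(zeta) = a_{n/N}(1), the defect vanishes at all 2^s-th roots of unity
     other than 1, and it is 2^s (1 + t + ... + t^(2^s - 1)) B(t) with B in Z[t].
   The coefficient equals q B(t) up to an odd factor, and B(t) = B(1) mod 2.
   At t = 1 and for n >= 1, - 2 a_n is the n-th coefficient of 1 / sqrt (1 + 4 z),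
   namely (-1)^n binomial(2n, n), and a congruence modulo 8 (n/2)^2 between central
   binomial coefficients shows that B(1) is even for n >= 3. *)

(** * Power series over a commutative ring: fixed points, inverses, logarithmic derivatives,
    substitutions *)

Section PowerSeries.
Variable A : comNzRingType.
Implicit Types (a b f g u : fps A) (c t : A).

Lemma fpsD a b n : (a + b) n = a n + b n. Proof. by []. Qed.
Lemma fpsN a n : (- a) n = - a n. Proof. by []. Qed.
Lemma fpsB a b n : (a - b) n = a n - b n. Proof. by []. Qed.
Lemma fpsZ c a n : (c *: a) n = c * a n. Proof. by []. Qed.
Lemma fps1 n : (1 : fps A) n = (n == 0%N)%:R. Proof. by []. Qed.
Lemma fpsM a b n : (a * b) n = \sum_(i < n.+1) a i * b (n - i)%N.
Proof. by []. Qed.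

Lemma fps_sum (I : Type) (s : seq I) (P : pred I) (F : I -> fps A) n :
  (\sum_(i <- s | P i) F i) n = \sum_(i <- s | P i) F i n.
Proof. by elim/big_rec2: _ => // i x y _ <-. Qed.

Lemma fpsMn a k n : (a *+ k) n = a n *+ k.
Proof. by elim: k => // k IHk; rewrite !mulrS fpsD IHk. Qed.

Lemma fpsM0 a b : (a * b) 0%N = a 0%N * b 0%N.
Proof. by rewrite fpsM big_ord1. Qed.

Lemma fpsXn0 a k : (a ^+ k) 0%N = a 0%N ^+ k.
Proof. by elim: k => // k IHk; rewrite !exprS fpsM0 IHk. Qed.

Lemma fps_scaleAl c a b : c *: (a * b) = (c *: a) * b.
Proof.
apply: fpsP => n; rewrite fpsZ !fpsM mulr_sumr; apply: eq_bigr => i _.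
by rewrite fpsZ mulrA.
Qed.

HB.instance Definition _ := GRing.Lmodule_isLalgebra.Build A (fps A) fps_scaleAl.
HB.instance Definition _ := GRing.Lalgebra_isComAlgebra.Build A (fps A).

Lemma fps_mulX a n : (fpsX * a) n = if n is m.+1 then a m else 0.
Proof.
rewrite fpsM; case: n => [|n]; first by rewrite big_ord1 mul0r.
rewrite big_ord_recl mul0r add0r big_ord_recl mul1r subn1 big1 ?addr0 //.
by move=> i _; rewrite mul0r.
Qed.

Lemma fps_mulXn k a n :
  (fpsX ^+ k * a) n = if (n < k)%N then 0 else a (n - k)%N.
Proof.
elim: k n => [|k IHk] n; first by rewrite expr0 mul1r subn0.
by rewrite exprS -mulrA fps_mulX; case: n => // n; rewrite IHk ltnS subSS.
Qed.

Lemma fps_Xn k n : (fpsX ^+ k : fps A) n = (n == k)%:R.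
Proof.
rewrite -[_ ^+ k]mulr1 fps_mulXn fps1.
by case: ltngtP => [//|lt_kn|->]; rewrite ?subnn // subn_eq0 leqNgt lt_kn.
Qed.

Lemma fps_decomp a : a = (a 0%N)%:A + fpsX * Fps (fun n => a n.+1).
Proof.
apply: fpsP => n; rewrite fpsD fpsZ fps1 fps_mulX.
by case: n => [|n]; rewrite /= ?mulr1 ?addr0 // mulr0 add0r.
Qed.

Lemma fps_order_expr u a k n : u 0%N = 0 -> (n < k)%N -> (u ^+ k * a) n = 0.
Proof.
move=> u0 ltnk; rewrite (fps_decomp u) u0 scale0r add0r exprMn -mulrA.
by rewrite fps_mulXn ltnk.
Qed.

Definition contracting (Phi : fps A -> fps A) := forall n a b,
  (forall i, (i < n)%N -> a i = b i) -> Phi a n = Phi b n.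

(** A contracting map gains one correct coefficient per iteration, so the coefficient of z^n is
    final after n + 1 iterations from any start. *)
Definition fps_fix (Phi : fps A -> fps A) : fps A :=
  Fps (fun n => iter n.+1 Phi 0 n).

Lemma fps_fixE Phi : contracting Phi -> Phi (fps_fix Phi) = fps_fix Phi.
Proof.
move=> ctr.
have itE m : forall a b i, (i < m)%N -> iter m Phi a i = iter m Phi b i.
  elim: m => // m IHm a b i ltim /=; apply: ctr => j ltji.
  by apply: IHm; apply: leq_trans ltji _.
apply: fpsP => n /=; apply: ctr => i lt_in /=.
by rewrite -/(iter i.+1 Phi 0) -[in RHS](subnK lt_in) addnC iterD; apply: itE.
Qed.

Lemma contracting_mulX (Phi : fps A -> fps A) :
  (forall n a b, (forall i, (i <= n)%N -> a i = b i) -> Phi a n = Phi b n) ->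
  contracting (fun a => fpsX * Phi a).
Proof.
by move=> loc [|n] a b ab; rewrite !fps_mulX //; apply: loc => i; apply: ab.
Qed.

(** The fixed-point form of the geometric series in 1 - f. It is an inverse of [f] when the constant
    coefficient of [f] is 1. *)
Definition fps_inv f : fps A := fps_fix (fun b => 1 + (1 - f) * b).

Lemma fps_invE f : f 0%N = 1 -> f * fps_inv f = 1.
Proof.
move=> f0; rewrite /fps_inv; set Phi := fun b : fps A => _.
set b := fps_fix _; have bE : Phi b = b.
  apply: fps_fixE => n x y xy; rewrite /Phi !fpsD !fpsM; congr (_ + _).
  rewrite !big_ord_recl fpsB f0 fps1 subrr !mul0r; congr (_ + _).
  apply: eq_bigr => i _; rewrite xy // ltn_subrL.
  by case: n xy i => // xy [].
have -> : f * b = b - (Phi b - 1) by rewrite /Phi; ring.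
by rewrite bE; ring.
Qed.

Lemma fps_mulI f : f 0%N = 1 -> GRing.lreg f.
Proof.
move=> f0 a b /(congr1 ( *%R (fps_inv f))).
by rewrite !mulrA ![_ * f]mulrC fps_invE // !mul1r.
Qed.

Definition theta a : fps A := Fps (fun n => n%:R * a n).

Lemma thetaE a n : theta a n = n%:R * a n. Proof. by []. Qed.

Lemma thetaD a b : theta (a + b) = theta a + theta b.
Proof. by apply: fpsP => n; rewrite /= mulrDr. Qed.

Lemma thetaM a b : theta (a * b) = theta a * b + a * theta b.
Proof.
apply: fpsP => n; rewrite fpsD !fpsM /= mulr_sumr -big_split /=.
apply: eq_bigr => i _.
have -> : n%:R = i%:R + (n - i)%:R :> A by rewrite -natrD subnKC ?leq_ord.
by ring.
Qed.

Lemma thetaX a k : theta (a ^+ k.+1) = (a ^+ k * theta a) *+ k.+1.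
Proof.
elim: k => [|k IHk]; first by rewrite expr0 expr1 mul1r.
by rewrite exprS thetaM IHk mulrnAr mulrA -exprS mulrC -mulrS.
Qed.

Lemma theta1 : theta 1 = 0.
Proof. by apply: fpsP => -[|n]; rewrite /= ?mul0r // mulr0. Qed.

(** This is z f'/f. Its n-th coefficient is n times that of log f, yet it needs no division by
    integers and so makes sense over Z[t]. *)
Definition dlog f : fps A := fps_inv f * theta f.

Lemma dlogE f : f 0%N = 1 -> f * dlog f = theta f.
Proof. by move=> f0; rewrite mulrA fps_invE // mul1r. Qed.

Lemma dlog0 f : dlog f 0%N = 0.
Proof. by rewrite fpsM0 thetaE mul0r mulr0. Qed.

Lemma dlog_uniq f a : f 0%N = 1 -> f * a = theta f -> dlog f = a.
Proof. by move=> f0 e; apply: (fps_mulI f0); rewrite e dlogE. Qed.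

Lemma dlogM f g : f 0%N = 1 -> g 0%N = 1 -> dlog (f * g) = dlog f + dlog g.
Proof.
move=> f0 g0; apply: dlog_uniq; first by rewrite fpsM0 f0 g0 mul1r.
by rewrite thetaM -(dlogE f0) -(dlogE g0); ring.
Qed.

Lemma dlog1 : dlog 1 = 0.
Proof. by apply: dlog_uniq; rewrite // mulr0 theta1. Qed.

Lemma fps_prod0 (I : Type) (s : seq I) (F : I -> fps A) :
  (forall i, F i 0%N = 1) -> (\prod_(i <- s) F i) 0%N = 1.
Proof.
by move=> F0; elim/big_ind: _ => // x y x0 y0; rewrite fpsM0 x0 y0 mul1r.
Qed.

Lemma dlog_prod (I : Type) (s : seq I) (F : I -> fps A) :
  (forall i, F i 0%N = 1) -> dlog (\prod_(i <- s) F i) = \sum_(i <- s) dlog (F i).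
Proof.
move=> F0; elim: s => [|i s IHs]; first by rewrite !big_nil dlog1.
by rewrite !big_cons dlogM ?IHs // fps_prod0.
Qed.

Definition dil t a : fps A := Fps (fun n => t ^+ n * a n).

Lemma dilE t a n : dil t a n = t ^+ n * a n. Proof. by []. Qed.

Lemma dil_sub t : {morph dil t : a b / a - b}.
Proof. by move=> a b; apply: fpsP => n; rewrite /= mulrBr. Qed.
Lemma dil_mul t : {morph dil t : a b / a * b}.
Proof.
move=> a b; apply: fpsP => n; rewrite /= mulr_sumr; apply: eq_bigr => i _.
by rewrite mulrACA -exprD subnKC // leq_ord.
Qed.
Lemma dil_one t : dil t 1 = 1.
Proof. by apply: fpsP => -[|n]; rewrite /= ?mulr1 // mulr0. Qed.

HB.instance Definition _ t := GRing.isZmodMorphism.Build _ _ (dil t) (@dil_sub t).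
HB.instance Definition _ t :=
  GRing.isMonoidMorphism.Build _ _ (dil t) (dil_one t, @dil_mul t).

Lemma dilZ t c a : dil t (c *: a) = c *: dil t a.
Proof. by apply: fpsP => n; rewrite /= mulrCA. Qed.

Lemma dil_dil s t a : dil s (dil t a) = dil (s * t) a.
Proof. by apply: fpsP => n; rewrite /= exprMn mulrA. Qed.

Lemma dil_1 a : dil 1 a = a.
Proof. by apply: fpsP => n; rewrite /= expr1n mul1r. Qed.

Lemma dilX t : dil t fpsX = t *: fpsX.
Proof. by apply: fpsP => -[|[|n]]; rewrite /= ?mulr0. Qed.

Lemma dil0 t a : dil t a 0%N = a 0%N.
Proof. by rewrite /= mul1r. Qed.

Lemma dlog_dil t f : f 0%N = 1 -> dlog (dil t f) = dil t (dlog f).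
Proof.
move=> f0; apply: dlog_uniq; first by rewrite dil0.
by rewrite -rmorphM /= dlogE //; apply: fpsP => n; rewrite /= mulrCA.
Qed.

Variable d : nat.
Hypothesis d_gt0 : (0 < d)%N.
Local Notation pow := (fps_subst_pow d).

Lemma fps_powE a n : pow a n = if (d %| n)%N then a (n %/ d)%N else 0.
Proof. by []. Qed.

Lemma sum_dvdn k (G : nat -> A) :
  \sum_(i < (k * d).+1 | (d %| i)%N) G i = \sum_(j < k.+1) G (j * d)%N.
Proof.
rewrite -(big_mkord (fun i => (d %| i)%N) G).
rewrite -(big_mkord xpredT (fun j => G (j * d)%N)).
elim: k => [|k IHk]; first by rewrite mul0n big_mkcond !big_nat1 dvdn0.
rewrite big_nat_recr //= -IHk (@big_cat_nat _ _ _ (k * d).+1) //=; last first.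
  by rewrite ltnS leq_mul2r leqnSn orbT.
congr (_ + _); rewrite mulSn addnC big_mkcond big_nat_recr /=; last first.
  by rewrite -[X in (X < _)%N]addn0 ltn_add2l.
rewrite dvdn_addr ?dvdn_mull // dvdnn big1_seq ?add0r // => i.
rewrite mem_index_iota /= => /andP[lb ub].
case: ifP => // /dvdnP[j ej]; move: lb ub; rewrite ej -mulSnr !ltn_mul2r d_gt0 /=.
by move=> lb; rewrite ltnS leqNgt lb.
Qed.

Lemma fps_pow_mul : {morph (pow : fps A -> fps A) : a b / a * b}.
Proof.
move=> a b; apply: fpsP => n; rewrite fpsM /=.
case: ifPn => [/dvdnP[k ->]|ndn].
  rewrite mulnK //.
  have /esym eG := sum_dvdn k (fun i => a (i %/ d)%N * b (k - i %/ d)%N).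
  under eq_bigr => j _ do rewrite -{1 2}(mulnK j d_gt0).
  rewrite {}eG.
  rewrite big_mkcond; apply: eq_bigr => i _.
  case: ifPn => [di|_]; last by rewrite mul0r.
  by rewrite dvdn_sub ?dvdn_mull // divnBr ?mulnK.
rewrite big1 // => i _; case: ifPn => [di|]; last by rewrite mul0r.
by rewrite dvdn_subl ?leq_ord // (negPf ndn) mulr0.
Qed.

Lemma fps_pow_X : pow fpsX = fpsX ^+ d :> fps A.
Proof.
apply: fpsP => n; rewrite fps_Xn /=; case: ifPn => [/dvdnP[k ->]|].
  by rewrite mulnK // -[X in _ = (_ == X)%:R]mul1n eqn_pmul2r.
by move=> nd; case: eqP nd => // ->; rewrite dvdnn.
Qed.

Lemma fps_pow_const a : pow a 0%N = a 0%N.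
Proof. by rewrite /= dvdn0 div0n. Qed.

Lemma dil_pow t a : dil t (pow a) = pow (dil (t ^+ d) a).
Proof.
apply: fpsP => n /=; case: ifP => [/dvdnP[k ->]|_]; last by rewrite mulr0.
by rewrite mulnK // mulnC exprM.
Qed.

Lemma dlog_pow f : f 0%N = 1 -> dlog (pow f) = pow (dlog f) *+ d.
Proof.
move=> f0; apply: dlog_uniq; first by rewrite fps_pow_const.
rewrite mulrnAr -fps_pow_mul dlogE //; apply: fpsP => n; rewrite fpsMn /=.
case: ifP => [/dvdnP[k ->]|_]; last by rewrite mul0rn mulr0.
by rewrite mulnK // natrM -mulr_natl; ring.
Qed.

End PowerSeries.

(** * Change of coefficient ring *)

Section FpsMap.
Variables (A B : comNzRingType) (phi : {rmorphism A -> B}).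

Lemma fps_map_sub : {morph (fps_map phi : fps A -> fps B) : a b / a - b}.
Proof. by move=> a b; apply: fpsP => n; rewrite /= rmorphB. Qed.
Lemma fps_map_one : fps_map phi 1 = 1.
Proof. by apply: fpsP => n; rewrite /= rmorph_nat. Qed.
Lemma fps_map_mul : {morph (fps_map phi : fps A -> fps B) : a b / a * b}.
Proof.
move=> a b; apply: fpsP => n; rewrite /= rmorph_sum.
by apply: eq_bigr => i _; rewrite rmorphM.
Qed.

HB.instance Definition _ :=
  GRing.isZmodMorphism.Build _ _ (fps_map phi) fps_map_sub.
HB.instance Definition _ :=
  GRing.isMonoidMorphism.Build _ _ (fps_map phi) (fps_map_one, fps_map_mul).

Lemma fps_map_dil t a : fps_map phi (dil t a) = dil (phi t) (fps_map phi a).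
Proof. by apply: fpsP => n; rewrite /= rmorphM rmorphXn. Qed.

Lemma fps_map_scale c a : fps_map phi (c *: a) = phi c *: fps_map phi a.
Proof. by apply: fpsP => n; rewrite /= rmorphM. Qed.

Lemma fps_map_X : fps_map phi fpsX = fpsX.
Proof. by apply: fpsP => n; rewrite /= rmorph_nat. Qed.

Lemma dlog_map (f : fps A) :
  f 0%N = 1 -> dlog (fps_map phi f) = fps_map phi (dlog f).
Proof.
move=> f0; apply: dlog_uniq; first by rewrite /= f0 rmorph1.
rewrite -rmorphM /= dlogE //; apply: fpsP => n.
by rewrite /= rmorphM rmorph_nat.
Qed.

End FpsMap.

(** * The Rogers-Ramanujan continued fraction and its functional equation *)

Section RogersRamanujan.
Variable A : comNzRingType.
Implicit Types (t c : A) (R S y E : fps A).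

(* R = 1 + t z / (1 + t^2 z / (1 + t^3 z / ...)) *)
Definition RR_tail t : fps A :=
  fps_fix (fun T => t%:A + fpsX * (- t%:A * T * dil t T)).
Definition RR t : fps A := 1 + fpsX * RR_tail t.

(** For R = 1 + z T this is R(z) R(tz) = R(tz) + t z with one factor z removed. *)
Lemma RR_tailE t :
  RR_tail t = t%:A + fpsX * (- t%:A * RR_tail t * dil t (RR_tail t)).
Proof.
rewrite [LHS]/RR_tail -fps_fixE // => n a b ab; rewrite !fpsD; congr (_ + _).
apply: (contracting_mulX (Phi := fun T => - t%:A * T * dil t T)) ab.
move=> {}n {}a {}b ab.
rewrite !fpsM; apply: eq_bigr => i _; rewrite !fpsM /= !ab ?leq_subr //.
congr (_ * _); apply: eq_bigr => j _.
by rewrite ab // (leq_trans (leq_subr _ _)) ?leq_ord.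
Qed.

Lemma RR0 t : RR t 0%N = 1.
Proof. by rewrite fpsD fps_mulX addr0. Qed.

Lemma RR_S t n : RR t n.+1 = RR_tail t n.
Proof. by rewrite fpsD fps1 fps_mulX add0r. Qed.

Lemma RRE t : RR t * dil t (RR t) = dil t (RR t) + t *: fpsX.
Proof.
have eX : t *: fpsX = t%:A * fpsX :> fps A by rewrite -scalerAl mul1r.
rewrite /RR rmorphD rmorphM rmorph1 /= dilX eX.
set T := RR_tail t; set T' := dil t T.
have -> : (1 + fpsX * T) * (1 + t%:A * fpsX * T')
  = 1 + t%:A * fpsX * T' + fpsX * (T - (fpsX * (- t%:A * T * T'))) by ring.
by rewrite {1}/T RR_tailE -/T -/T'; ring.
Qed.

(* With c = 0 this is uniqueness of the solution; with c = 2, uniqueness modulo 2. *)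
Lemma RR_uniq_mod c t y R S E :
  R 0%N = 1 -> S 0%N = 1 -> R * dil t R = dil t R + y ->
  S * dil t S = dil t S + y + c *: E -> exists G, S = R + c *: G.
Proof.
move=> R0 S0 eR eS; pose D := S - R.
suff: forall n, exists g, D n = c * g.
  case/choice => G DG; exists (Fps G); apply: fpsP => n.
  by rewrite fpsD fpsZ /= -DG fpsB addrC subrK.
(* Subtracting the two equations gives a linear one for D. Both [1 - dil t S] and [1 - R] have
   constant coefficient 0, so modulo [c] the coefficient [D n] depends on earlier ones only. *)
have eD : D = D * (1 - dil t S) + (1 - R) * dil t D + c *: E.
  rewrite /D rmorphB /=.
  have -> : c *: E = S * dil t S - dil t S - y by rewrite eS; ring.
  have -> : y = R * dil t R - dil t R by rewrite eR; ring.
  by ring.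
clearbody D; elim/ltn_ind => n IHn; rewrite eD !fpsD !fpsM fpsZ.
have dvd_sum (F : 'I_n.+1 -> A) :
    (forall i, exists g, F i = c * g) -> exists g, \sum_i F i = c * g.
  by case/choice => G FG; exists (\sum_i G i); rewrite mulr_sumr; apply: eq_bigr.
have [|g1 ->] := dvd_sum (fun i => D i * (1 - dil t S) (n - i)%N).
  move=> i; have [lt_in|le_ni] := ltnP i n.
    have [g ->] := IHn _ lt_in.
    by exists (g * (1 - dil t S) (n - i)%N); rewrite mulrA.
  have -> : (n - i = 0)%N by apply/eqP; rewrite subn_eq0.
  exists 0; rewrite [X in _ * X](_ : _ = 0) ?mulr0 //.
  by rewrite fpsB dil0 S0 subrr.
have [|g2 ->] := dvd_sum (fun i => (1 - R) i * dil t D (n - i)%N).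
  move=> [[|i] lt_in].
    exists 0; rewrite [X in X * _](_ : _ = (1 - R) 0%N) //.
    by rewrite fpsB R0 subrr mul0r mulr0.
  rewrite /=.
  have [|g ->] := IHn (n - i.+1)%N.
    by rewrite ltn_subrL; case: n lt_in {IHn dvd_sum g1}.
  exists ((1 - R) i.+1 * (t ^+ (n - i.+1) * g)).
  by rewrite (mulrCA (t ^+ _) c) (mulrCA _ c).
by exists (g1 + g2 + E n); rewrite !mulrDr.
Qed.

Lemma RR_uniq t R :
  R 0%N = 1 -> R * dil t R = dil t R + t *: fpsX -> R = RR t.
Proof.
move=> R0 eR; have [|G ->] := @RR_uniq_mod 0 t _ _ _ 0 (RR0 t) R0 (RRE t).
  by rewrite scale0r addr0.
by rewrite scale0r addr0.
Qed.

End RogersRamanujan.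

(** The image of [RR t] solves the functional equation for [phi t], so uniqueness applies. *)
Lemma RR_map (A B : comNzRingType) (phi : {rmorphism A -> B}) t :
  fps_map phi (RR t) = RR (phi t).
Proof.
apply: RR_uniq; first by rewrite -[LHS]/(phi (RR t 0%N)) RR0 rmorph1.
by rewrite -fps_map_dil -rmorphM /= RRE rmorphD /= fps_map_scale fps_map_X.
Qed.

(** * A Dwork-type congruence modulo powers of 2 *)

Section Dwork.
Variable A : comNzRingType.
Implicit Types (t : A).
Local Notation pow2 := (fps_subst_pow 2).

(** Modulo 2, both series solve X(z) X(tz) = X(tz) + (t z)^2: the left one by squaring [RRE], whose
    cross term is even, the right one by substituting t^2 and z^2 in [RRE]. *)
Lemma RR_sq_mod2 t : exists U, RR t ^+ 2 = pow2 (RR (t ^+ 2)) + 2%:R *: U.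
Proof.
pose R := RR t; pose R2 := pow2 (RR (t ^+ 2)); pose y : fps A := (t *: fpsX) ^+ 2.
apply: (@RR_uniq_mod _ 2%:R t y R2 (R ^+ 2) (dil t R * (t *: fpsX))).
- by rewrite fps_pow_const RR0.
- by rewrite fpsXn0 RR0 expr1n.
- rewrite /R2 dil_pow //.
  transitivity (pow2 (RR (t ^+ 2) * dil (t ^+ 2) (RR (t ^+ 2)))).
    by rewrite fps_pow_mul.
  rewrite RRE.
  have fps_powD a b : pow2 (a + b) = pow2 a + pow2 b :> fps A.
    by apply: fpsP => n; rewrite /=; case: ifP; rewrite ?addr0.
  rewrite fps_powD; congr (_ + _); apply: fpsP => n.
  rewrite /y exprZn fpsZ -fps_pow_X //=.
  by case: ifP; rewrite ?mulr0.
rewrite rmorphXn /= -exprMn RRE -/R /y.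
by rewrite scaler_nat; ring.
Qed.

(** Each squaring improves the congruence by one factor 2. *)
Lemma expr_congr2 (f g U : fps A) k : f = g + 2%:R * U ->
  exists V, f ^+ (2 ^ k) = g ^+ (2 ^ k) + 2%:R ^+ k.+1 * V.
Proof.
move=> fg; elim: k => [|k [V IHk]]; first by exists U; rewrite !expr1.
exists (g ^+ (2 ^ k) * V + 2%:R ^+ k * V ^+ 2).
by rewrite expnSr !exprM IHk !exprS; ring.
Qed.

Hypothesis two_reg : GRing.lreg (2%:R : A).

(** Raise [RR_sq_mod2] to a power of 2 and compare logarithmic derivatives. The error is [theta] of
    a series, up to a multiple of the modulus, and [theta] multiplies the n-th coefficient by n. *)
Lemma RR_dlog_congr t k n : (2 ^ k %| n)%N ->
  exists c, dlog (RR t) n - pow2 (dlog (RR (t ^+ 2))) n = 2%:R ^+ k * c.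
Proof.
case: k => [|k] dvd_n; first by eexists; rewrite expr0 mul1r.
pose f := RR t ^+ 2; pose g := pow2 (RR (t ^+ 2)).
pose a := dlog (RR t); pose b := pow2 (dlog (RR (t ^+ 2))).
have g0 : g 0%N = 1 by rewrite fps_pow_const RR0.
have f0 : f 0%N = 1 by rewrite fpsXn0 RR0 expr1n.
have [U0 fg] := RR_sq_mod2 t; rewrite scaler_nat -mulr_natl in fg.
have [U eU] := expr_congr2 k fg; rewrite -/f -/g in eU.
set M := (2 ^ k)%N in eU; pose e : fps A := 2%:R ^+ k.+1.
have M_gt0 : (0 < M)%N by rewrite expn_gt0.
have eM : 2%:R * M%:R = e by rewrite /e exprS natrX.
have thX (x : fps A) y : theta x = x * (2%:R * y) -> theta (x ^+ M) = e * y * x ^+ M.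
  move=> thx; rewrite -{1}(prednK M_gt0) thetaX prednK // thx -mulr_natr -eM.
  have -> : x ^+ M = x ^+ M.-1 * x by rewrite -exprSr prednK.
  by ring.
have thf : theta (f ^+ M) = e * a * f ^+ M.
  by apply: thX; rewrite /f thetaX expr1 -(dlogE (RR0 t)) -/a -mulr_natr; ring.
have thg : theta (g ^+ M) = e * b * g ^+ M.
  by apply: thX; rewrite -(dlogE g0) dlog_pow ?RR0 // mulr_natl.
have the : theta e = 0.
  by rewrite /e -natrX; elim: (2 ^ k.+1)%N => [|m IHm];
   [apply: fpsP => n'; rewrite /= mulr0 | rewrite mulrS thetaD IHm theta1 addr0].
have e_reg : GRing.lreg e.
  move=> x y exy; apply: fpsP => i.
  have : (e * x) i = (e * y) i by rewrite exy.
  rewrite /e -natrX !mulr_natl !fpsMn -(mulr_natl (x i)) -(mulr_natl (y i)) natrX.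
  exact: lregX.
have gM0 : (g ^+ M) 0%N = 1 by rewrite fpsXn0 g0 expr1n.
pose V := U * fps_inv (g ^+ M).
have eUV : U = V * g ^+ M by rewrite -mulrA [_ * g ^+ M]mulrC fps_invE // mulr1.
clearbody V.
(* Apply [theta] to [eU] with U = V g^M, then cancel e and g^M. The term e ((a - b) V) is visibly
   divisible by e, and the n-th coefficient of [theta V] is n V_n. *)
have ab : a - b = theta V - e * ((a - b) * V).
  apply: (fps_mulI gM0); apply: e_reg.
  have := congr1 (@theta A) eU; rewrite thf eU !(thetaD, thetaM) thg -/e the eUV.
  rewrite thetaM thg => h.
  transitivity (e * a * (g ^+ M + e * (V * g ^+ M)) - e * b * g ^+ M
    - e * e * a * V * g ^+ M).
    by ring.
  by rewrite h; ring.
have eC (x : fps A) i : (e * x) i = 2%:R ^+ k.+1 * x i.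
  by rewrite /e -natrX mulr_natl fpsMn -(mulr_natl (x i)) natrX.
have /dvdnP[m en] := dvd_n; pose W := (a - b) * V.
exists (m%:R * V n - W n).
rewrite -fpsB -/a -/b ab fpsB eC -/W -[theta V n]/(n%:R * V n).
have -> : n%:R = m%:R * 2%:R ^+ k.+1 :> A by rewrite en natrM natrX.
by ring.
Qed.

End Dwork.

(** * Transfer matrices at roots of unity of order a power of 2 *)

Section RootsOfUnity.
Variable A : idomainType.
Implicit Types (t : A).

(* Row vector r multiplied by the matrices [[1, t^i z], [1, 0]], 1 <= i <= k;
   these matrices map (R(t^i z), 1) to R(t^i z) (R(t^(i-1) z), 1). *)
Fixpoint transfer t (r : fps A * fps A) k : fps A * fps A :=
  if k is k'.+1 then
    let s := transfer t r k' in (s.1 + s.2, t ^+ k *: fpsX * s.1)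
  else r.

Definition RR_prod t k : fps A := \prod_(1 <= i < k.+1) dil (t ^+ i) (RR t).

(** The action on the column (R, 1) telescopes. When t^k = 1 the column returns to itself, so
    [RR_prod t k] is an eigenvalue of the product of the k matrices. *)
Lemma transfer_eigen t r k :
  (transfer t r k).1 * dil (t ^+ k) (RR t) + (transfer t r k).2
    = RR_prod t k * (r.1 * RR t + r.2).
Proof.
elim: k => [|k IHk] /=; first by rewrite expr0 dil_1 /RR_prod big_nil mul1r.
rewrite /RR_prod big_nat_recr //= -/(RR_prod t k) mulrAC -IHk.
have : dil (t ^+ k) (RR t) * dil (t ^+ k.+1) (RR t)
    = dil (t ^+ k.+1) (RR t) + t ^+ k.+1 *: fpsX.
  rewrite exprSr -[X in _ * X]dil_dil -rmorphM RRE rmorphD /= dil_dil.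
  by rewrite dilZ dilX scalerA [t * _]mulrC.
set u := _ *: fpsX; set R' := dil (t ^+ k.+1) _ => e.
by rewrite [in RHS]mulrDl -mulrA e; ring.
Qed.

Lemma transfer_det t k :
  let r := transfer t (1, 0) k in let s := transfer t (0, 1) k in
  r.1 * s.2 - r.2 * s.1 = (- 1) ^+ k * t ^+ 'C(k.+1, 2) *: fpsX ^+ k.
Proof.
elim: k => [|k /= IHk] /=; first by rewrite !expr0 !mulr1 mul0r subr0 scale1r.
set r := transfer t (1, 0) k in IHk *; set s := transfer t (0, 1) k in IHk *.
transitivity (- (t ^+ k.+1 *: fpsX) * (r.1 * s.2 - r.2 * s.1)); first by ring.
rewrite IHk -scaleNr -scalerAl -scalerAr scalerA -exprS [in RHS]binS bin1.
by congr (_ *: _); rewrite exprD [(- 1) ^+ k.+1]exprS; ring.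
Qed.

(** Each matrix raises the degree in z by one half on average. Hence the trace of a product of N
    matrices has degree at most N/2, below N. *)
Lemma transfer_degree t (r : fps A * fps A) e k :
  (forall i, (e < i.*2.+1)%N -> r.1 i = 0) ->
  (forall i, (e < i.*2)%N -> r.2 i = 0) ->
  (forall i, (k + e < i.*2.+1)%N -> (transfer t r k).1 i = 0) /\
  (forall i, (k + e < i.*2)%N -> (transfer t r k).2 i = 0).
Proof.
move=> r1 r2; elim: k => [|k [IH1 IH2]] //; split=> i lt_i.
  rewrite [LHS](_ : _ = ((transfer t r k).1 + (transfer t r k).2) i) //.
  by rewrite fpsD IH1 ?IH2 ?addr0 //; lia.
rewrite [LHS](_ : _ = (t ^+ k.+1 *: fpsX * (transfer t r k).1) i) //.
rewrite -scalerAl fpsZ fps_mulX; case: i lt_i => [|i] lt_i; first by rewrite mulr0.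
by rewrite IH1 ?mulr0 //; lia.
Qed.

Lemma RR_prod0 t k : RR_prod t k 0%N = 1.
Proof. by apply: fps_prod0 => i; rewrite dil0 RR0. Qed.

Lemma RR_prod_dil t k : t ^+ k = 1 -> dil t (RR_prod t k) = RR_prod t k.
Proof.
case: k => [|k] tk; first by rewrite /RR_prod !big_nil rmorph1.
rewrite /RR_prod rmorph_prod /= big_nat_recr //= [RHS]big_nat_recl //= mulrC.
rewrite dil_dil -exprS; congr (_ * _); first by rewrite exprS tk mulr1 expr1.
by apply: eq_bigr => i _; rewrite dil_dil exprS.
Qed.

(** This turns the determinant into -z^N for N = 2^j. If N = 1 the sign comes from (-1)^N; otherwise
    t^(N/2) = -1 is raised to the odd power N + 1. *)
Lemma primitive_exp2_sign j t : (2 ^ j).-primitive_root t ->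
  (- 1) ^+ (2 ^ j) * t ^+ 'C((2 ^ j).+1, 2) = - 1.
Proof.
case: j => [|j] prim_t.
  by have := prim_expr_order prim_t; rewrite expn0 binn !expr1 => ->; rewrite mulr1.
have t2 : t ^+ (2 ^ j) = - 1.
  have : t ^+ (2 ^ j) ^+ 2 = 1 by rewrite -exprM -expnSr prim_expr_order.
  move/eqP; rewrite sqrf_eq1 -(prim_order_dvd prim_t) dvdn_Pexp2l //.
  by rewrite ltnn /= => /eqP.
have -> : 'C((2 ^ j.+1).+1, 2) = (2 ^ j * (2 ^ j.+1).+1)%N.
  by rewrite bin2 /= mulnC expnS -mulnA mul2n doubleK.
rewrite exprM t2 -exprD -[RHS]expr1 -signr_odd -[in RHS]signr_odd.
by rewrite oddD /= addbN addbb.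
Qed.

Lemma RR_prod_quadratic j t : (2 ^ j).-primitive_root t ->
  RR_prod t (2 ^ j) ^+ 2 = RR_prod t (2 ^ j) + fpsX ^+ (2 ^ j).
Proof.
move=> prim_t; set N := (2 ^ j)%N; have N_gt0 : (0 < N)%N by rewrite expn_gt0.
have tN : t ^+ N = 1 := prim_expr_order prim_t.
set P := RR_prod t N.
have := transfer_eigen t (1, 0) N; have := transfer_eigen t (0, 1) N.
have := transfer_det t N.
have [] := @transfer_degree t (1, 0) 1 N.
- by move=> [|i] //=; rewrite fps1.
- by [].
have [] := @transfer_degree t (0, 1) 0 N.
- by [].
- by move=> [|i] //=; rewrite fps1.
rewrite /= primitive_exp2_sign //.
set r := transfer t (1, 0) N; set s := transfer t (0, 1) N.
rewrite tN dil_1 !mul0r !mul1r addr0 add0r mulr1 scaleN1r -/P.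
set R := RR t => _ s2 r1 _ det eig_s eig_r.
pose T := r.1 + s.2.
(* Cayley-Hamilton for the matrix with rows r and s: T is its trace, and its determinant is -z^N. *)
have eP : P ^+ 2 = T * P + fpsX ^+ N.
  have -> : fpsX ^+ N = - (r.1 * s.2 - r.2 * s.1) by rewrite det opprK.
  have er : r.2 = P * R - r.1 * R by rewrite -eig_r; ring.
  have es : s.2 = P - s.1 * R by rewrite -eig_s; ring.
  by rewrite /T er es; ring.
suff T1 : T = 1 by rewrite eP T1 mul1r.
(* P and z^N are invariant under z -> t z, hence so is T. As t has order N, only exponents divisible
   by N survive in T, and its degree is below N. *)
have dilT : dil t T = T.
  apply: (fps_mulI (RR_prod0 t N)); rewrite -/P.
  have -> : P * T = P ^+ 2 - fpsX ^+ N by rewrite eP; ring.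
  have := congr1 (dil t) eP.
  rewrite rmorphD rmorphM !rmorphXn /= RR_prod_dil // -/P => ->.
  rewrite dilX exprZn tN scale1r; ring.
apply: fpsP => i; rewrite fps1; case: (posnP i) => [->|i_gt0].
  have := congr1 (fun x : fps A => x 0%N) eP.
  rewrite fpsXn0 fpsD fpsM0 fps_Xn RR_prod0 mulr1 expr1n.
  by rewrite (ltn_eqF N_gt0) addr0 => <-.
have [lt_iN|le_Ni] := ltnP i N; last first.
  by rewrite fpsD r1 ?s2 ?addr0 ?(gtn_eqF i_gt0) //; lia.
have /eqP : t ^+ i * T i = T i by rewrite -[LHS]/(dil t T i) dilT.
rewrite -subr_eq0 -{2}[T i]mul1r -mulrBl mulf_eq0 subr_eq0.
by rewrite -(prim_order_dvd prim_t) gtnNdvd // => /eqP ->.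
Qed.

(** Both sides solve X^2 = X + z^N. Their difference is killed by P + Q - 1, which has constant
    coefficient 1 and is therefore regular. *)
Lemma RR_prod_pow j t : (2 ^ j).-primitive_root t ->
  RR_prod t (2 ^ j) = fps_subst_pow (2 ^ j) (RR 1).
Proof.
move=> prim_t; set N := (2 ^ j)%N; have N_gt0 : (0 < N)%N by rewrite expn_gt0.
set Q := fps_subst_pow _ _.
have eP := RR_prod_quadratic prim_t; rewrite -/N in eP.
set P := RR_prod t N in eP *.
have eQ : Q ^+ 2 = Q + fpsX ^+ N.
  have h := RRE (1 : A); rewrite dil_1 scale1r in h.
  rewrite expr2 /Q -fps_pow_mul // h -fps_pow_X //; apply: fpsP => n.
  by rewrite /=; case: ifP; rewrite ?addr0.
have Q0 : Q 0%N = 1 by rewrite fps_pow_const RR0.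
have PQ0 : (P + Q - 1) 0%N = 1 by rewrite fpsB fpsD RR_prod0 Q0 fps1 addrK.
apply: (fps_mulI PQ0); apply/eqP; rewrite -subr_eq0 -mulrBr; apply/eqP.
transitivity (P ^+ 2 - P - (Q ^+ 2 - Q)); first by ring.
by rewrite eP eQ; ring.
Qed.

(** Take [dlog] in [RR_prod_pow]. As t^n = 1, the N factors contribute equally at z^n; this N
    cancels the N produced by substituting z^N. *)
Lemma RR_dlog_root j t n : [pchar A] =i pred0 ->
  (2 ^ j).-primitive_root t -> (2 ^ j %| n)%N ->
  dlog (RR t) n = dlog (RR 1) (n %/ 2 ^ j)%N.
Proof.
move=> charA prim_t dvd_n; set N := (2 ^ j)%N.
have N_gt0 : (0 < N)%N by rewrite expn_gt0.
have : dlog (RR_prod t N) n = dlog (fps_subst_pow N (RR 1)) n.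
  by rewrite /N RR_prod_pow.
rewrite dlog_pow ?RR0 // fpsMn fps_powE dvd_n.
have -> : dlog (RR_prod t N) = \sum_(1 <= i < N.+1) dlog (dil (t ^+ i) (RR t)).
  by apply: dlog_prod => i; rewrite dil0 RR0.
rewrite fps_sum (eq_bigr (fun=> dlog (RR t) n)) => [|i _].
  rewrite sumr_const_nat subn1 /= -[LHS]mulr_natl -[RHS]mulr_natl.
  by apply: mulfI; rewrite ((pcharf0P A).1 charA) -lt0n.
rewrite dlog_dil ?RR0 // dilE -exprM.
have /dvdnP[m ->] := dvd_n.
by rewrite mulnA [(i * m * _)%N]mulnC exprM (prim_expr_order prim_t) expr1n mul1r.
Qed.

End RootsOfUnity.

(** * The defect as a polynomial in t, and its divisors *)

Definition RR_defect (A : comNzRingType) (t : A) n : A :=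
  dlog (RR t) n - fps_subst_pow 2 (dlog (RR (t ^+ 2))) n.

Lemma RR_defect_map (A B : comNzRingType) (phi : {rmorphism A -> B}) t n :
  phi (RR_defect t n) = RR_defect (phi t) n.
Proof.
have e u m : phi (dlog (RR u) m) = dlog (RR (phi u)) m.
  by rewrite -RR_map dlog_map ?RR0.
rewrite /RR_defect rmorphB !fps_powE; congr (_ - _); first exact: e.
by case: ifP => _; [rewrite -rmorphXn; apply: e | rewrite rmorph0].
Qed.

Definition int_eval (K : comNzRingType) (x : K) : {rmorphism {poly int} -> K} :=
  horner_eval x \o map_poly intr.

Lemma int_evalX (K : comNzRingType) (x : K) : int_eval x 'X = x.
Proof. by rewrite /= /horner_eval map_polyX hornerX. Qed.

(** With N = 2^(j+1), the square of [z] has order N/2, so [RR_dlog_root] sends both terms of the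
    defect to the coefficient of index n/N at t = 1. *)
Lemma RR_defect_root j n (z : algC) : (2 ^ j.+1).-primitive_root z ->
  (2 ^ j.+1 %| n)%N -> RR_defect z n = 0.
Proof.
move=> prim_z dvd_n; have dvd2 : (2 %| n)%N.
  by apply: dvdn_trans dvd_n; rewrite expnS dvdn_mulr.
have prim_z2 : (2 ^ j).-primitive_root (z ^+ 2).
  have := exp_prim_root prim_z 2; rewrite (gcdn_idPl _) ?expnS ?dvdn_mulr //.
  by rewrite mulKn.
have e1 := RR_dlog_root (Num.Theory.pchar_num _) prim_z dvd_n.
have /(RR_dlog_root (Num.Theory.pchar_num _) prim_z2) e2 : (2 ^ j %| n %/ 2)%N.
  by rewrite dvdn_divRL // mulnC -expnS.
apply/eqP; rewrite subr_eq0 fps_powE dvd2; apply/eqP.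
by apply: etrans e1 _; apply: etrans (esym e2); rewrite -divnMA -expnS.
Qed.

(** Division by a monic polynomial stays in Z[X], and the remainder has more roots than its degree
    allows unless it is 0. *)
Lemma monic_dvd_by_roots (p D : {poly int}) (rs : seq algC) :
  D \is monic -> (size D <= (size rs).+1)%N -> uniq rs ->
  (forall z, z \in rs -> int_eval z D = 0 /\ int_eval z p = 0) ->
  exists B, p = D * B.
Proof.
move=> monD szD uniq_rs rtDp; exists (Pdiv.Ring.rdivp p D).
have eD := Pdiv.RingMonic.rdivp_eq monD p.
suff rem0 : Pdiv.Ring.rmodp p D = 0 by rewrite {1}eD rem0 addr0 mulrC.
set r := Pdiv.Ring.rmodp p D in eD *.
apply/eqP/negPn/negP => r_neq0.
have sz_map : size (map_poly intr r : {poly algC}) = size r.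
  by rewrite size_map_inj_poly //; apply: intr_inj.
have rn0 : map_poly intr r != 0 :> {poly algC}.
  by rewrite -size_poly_eq0 sz_map size_poly_eq0.
have := max_poly_roots rn0 _ uniq_rs; rewrite sz_map => lt_r.
have := Pdiv.Ring.ltn_rmodpN0 p (monic_neq0 monD); rewrite -/r.
suff /lt_r : all (root (map_poly intr r)) rs.
  by move=> h1 h2; have := leq_trans h2 szD; rewrite ltnS leqNgt h1.
apply/allP => z zrs; have [zD zp] := rtDp z zrs.
have := congr1 (int_eval z) eD; rewrite rmorphD rmorphM zD zp mulr0 add0r.
by move=> h; apply/rootP; rewrite h.
Qed.

Definition qint (A : comNzRingType) (x : A) n : A := \sum_(i < n) x ^+ i.

Lemma qint_eval (K : comNzRingType) (x : K) n : int_eval x (qint 'X n) = qint x n.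
Proof.
rewrite rmorph_sum /=; apply: eq_bigr => i _.
by rewrite -{2}(int_evalX x) -rmorphXn.
Qed.

Lemma qint_monic n : qint ('X : {poly int}) n.+1 \is monic
  /\ size (qint ('X : {poly int}) n.+1) = n.+1.
Proof.
have -> : qint ('X : {poly int}) n.+1 = \poly_(i < n.+1) 1.
  by rewrite poly_def; apply: eq_bigr => i _; rewrite scale1r.
by rewrite monicE lead_coef_poly ?size_poly_eq ?oner_neq0.
Qed.

Lemma RR_defect_factor s n : (2 ^ s %| n)%N -> exists B : {poly int},
  RR_defect 'X n = 2%:R ^+ s * qint 'X (2 ^ s) * B.
Proof.
move=> dvd_n; have two_neq0 : (2%:R : {poly int}) != 0.
  by rewrite -polyC_natr polyC_eq0.
have [C eC] := RR_dlog_congr (mulfI two_neq0) 'X dvd_n.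
rewrite -/(RR_defect _ _) in eC; rewrite eC.
have N_gt0 : (0 < 2 ^ s)%N by rewrite expn_gt0.
have [z prim_z] := C_prim_root_exists N_gt0.
pose rs := [seq z ^+ i | i <- iota 1 (2 ^ s).-1].
have [monD szD] := qint_monic (2 ^ s).-1; rewrite prednK // in monD szD.
have [|||B ->] := @monic_dvd_by_roots C _ rs monD; last by exists B; ring.
- by rewrite szD size_map size_iota prednK.
- rewrite map_inj_in_uniq ?iota_uniq // => i k; rewrite !mem_iota => Hi Hk /eqP.
  by rewrite (eq_prim_root_expr prim_z) !modn_small => [/eqP||]; lia.
move=> _ /mapP[i Hi ->]; set x := z ^+ i; rewrite mem_iota in Hi.
have xN : x ^+ (2 ^ s) = 1 by rewrite exprAC (prim_expr_order prim_z) expr1n.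
have x_neq1 : x != 1.
  by rewrite -(prim_order_dvd prim_z) gtnNdvd //; lia.
split.
  rewrite qint_eval; apply: (mulfI (x := x - 1)); first by rewrite subr_eq0.
  by rewrite -subrX1 xN subrr mulr0.
(* The order of x divides 2^s and is not 1, so it is 2^(j+1) with j < s. It divides n, and
   [RR_defect_root] applies. *)
have [m prim_x] := prim_order_exists N_gt0 xN.
move=> /dvdn_pfactor[//|[|j] le_js em]; rewrite {m}em in prim_x.
  by have := prim_expr_order prim_x; rewrite expr1 => x1; rewrite x1 eqxx in x_neq1.
have := RR_defect_root prim_x (dvdn_trans (dvdn_exp2l 2 le_js) dvd_n).
rewrite -{1}(int_evalX x) -RR_defect_map eC rmorphM rmorphXn rmorph_nat.
by move/eqP; rewrite mulf_eq0 expf_eq0 Num.Theory.pnatr_eq0 andbF => /eqP.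
Qed.

(** * Central binomial coefficients and the defect at t = 1 *)

(* 1 / sqrt (1 + 4 z), with coefficients (-1)^n binomial(2n, n) *)
Definition cbin : fps int := 1 - dlog (RR 1) *+ 2.

Lemma cbin0 : cbin 0%N = 1.
Proof. by rewrite fpsB fpsMn dlog0 mul0rn subr0. Qed.

Lemma cbinS n : cbin n.+1 = - (2 * dlog (RR 1) n.+1).
Proof. by rewrite fpsB fpsMn fps1 sub0r mulr_natl. Qed.

Lemma cbin_rec n : n.+1%:R * cbin n.+1 = - (n.*2.*2.+2)%:R * cbin n.
Proof.
pose R : fps int := RR 1; pose a : fps int := dlog R; pose D := cbin.
(* At t = 1, R^2 = R + z, so E is the square root of 1 + 4 z. Differentiating the quadratic gives D
   E = 1; then (1 + 4 z) [theta D] = -2 z D is the recurrence. *)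
pose E : fps int := R *+ 2 - 1.
have R0 : R 0%N = 1 := RR0 1.
have R2 : R * R = R + fpsX by have := RRE (1 : int); rewrite dil_1 scale1r.
have E0 : E 0%N = 1 by rewrite fpsB fpsMn R0 fps1.
have thXX : theta fpsX = fpsX :> fps int.
  by apply: fpsP => -[|[|k]]; rewrite /= ?mulr0.
have Ea : R * (a * E) = R * (R - 1).
  have := congr1 (@theta int) R2.
  rewrite thetaM (thetaD R fpsX) thXX -(dlogE R0) -/a => h.
  transitivity (R * a * R + R * (R * a) - R * a); first by rewrite /E; ring.
  by rewrite h mulrBr R2; ring.
have {}Ea : a * E = R - 1 := fps_mulI R0 Ea.
have DE : D * E = 1 by rewrite /D /cbin -/R -/a mulrBl mulrnAl Ea mul1r /E; ring.
have E2 : E * E = 1 + fpsX *+ 4.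
  by transitivity ((R * R - R) *+ 4 + 1); [rewrite /E | rewrite R2]; ring.
have thE : E * theta E = fpsX *+ 2.
  have := congr1 (@theta int) E2; rewrite thetaM (thetaD 1) theta1 add0r.
  have -> : theta (fpsX *+ 4) = fpsX *+ 4 :> fps int.
    by rewrite !mulrS mulr0n addr0 !thetaD thXX.
  rewrite [theta E * E]mulrC => h; apply: fpsP => k.
  have := congr1 (fun x : fps int => x k) h; rewrite fpsD !fpsMn.
  by move: ((E * theta E) k) (fpsX k) => x y; rewrite !mulrS mulr0n; lra.
have thD : theta D * E * E = - (fpsX *+ 2) * D.
  have := congr1 (@theta int) DE; rewrite thetaM theta1 => /(congr1 ( *%R^~ E)).
  rewrite mul0r mulrDl -thE => /eqP; rewrite addr_eq0 => /eqP ->; ring.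
have {}thD : theta D + (fpsX * theta D) *+ 4 = - ((fpsX * D) *+ 2).
  transitivity (theta D * (E * E)); first by rewrite E2; ring.
  by rewrite mulrA thD; ring.
have := congr1 (fun x : fps int => x n.+1) thD.
rewrite fpsD fpsN !fpsMn !fps_mulX !thetaE.
rewrite -/cbin /D; move: (cbin n) (cbin n.+1) => x y h.
have -> : (n.*2.*2.+2)%:R = n%:R * 4 + 2 :> int.
  by rewrite -natrM -natrD; congr _%:R; lia.
move: h.
by rewrite !mulrS mulr0n; lra.
Qed.

Definition oddfact n : int := \prod_(k < n) (k.*2.+1)%:R.

Lemma oddfactS n : oddfact n.+1 = oddfact n * (n.*2.+1)%:R.
Proof. by rewrite /oddfact big_ord_recr. Qed.

Lemma cbin_fact n : cbin n * (n`!)%:R = (- 2) ^+ n * oddfact n.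
Proof.
elim: n => [|n IHn]; first by rewrite cbin0 /oddfact big_ord0.
rewrite factS natrM mulrA [cbin _ * _]mulrC cbin_rec -mulrA IHn oddfactS exprS.
have -> : (n.*2.*2.+2)%:R = 2 * (n.*2.+1)%:R :> int.
  by rewrite -natrM; congr _%:R; lia.
by ring.
Qed.

Lemma fact_double m : (m.*2`!)%:R = 2 ^+ m * (m`!)%:R * oddfact m :> int.
Proof.
elim: m => [|m IHm]; first by rewrite /oddfact big_ord0.
rewrite doubleS !factS !natrM IHm oddfactS exprS.
have -> : (m.*2.+2)%:R = 2 * m.+1%:R :> int by rewrite -natrM; congr _%:R; lia.
by ring.
Qed.

Lemma oddfact_double m :
  oddfact m.*2 = oddfact m * \prod_(k < m) ((m.*2)%:R + (k.*2.+1)%:R).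
Proof.
rewrite /oddfact -addnn big_split_ord /=; congr (_ * _).
by apply: eq_bigr => k _; rewrite -natrD; congr _%:R; lia.
Qed.

Lemma oddfact_rev m : oddfact m = \prod_(k < m) ((m.*2)%:R - (k.*2.+1)%:R).
Proof.
rewrite /oddfact (reindex_inj rev_ord_inj) /=; apply: eq_bigr => k _.
by rewrite -natrB; [congr _%:R|]; have := ltn_ord k; lia.
Qed.

(** The factors 2m + (2k + 1) form the upper half of the double factorial (4m - 1)!!. They are
    paired with 2m - (2k + 1), which run through (2m - 1)!! backwards. *)
Lemma cbin_double m :
  cbin m.*2 * oddfact m ^+ 2
    = cbin m * \prod_(k < m) ((k.*2.+1)%:R ^+ 2 - (m.*2)%:R ^+ 2).
Proof.
pose P : int := \prod_(k < m) ((m.*2)%:R + (k.*2.+1)%:R).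
have fm_neq0 : (m`!)%:R != 0 :> int by rewrite Num.Theory.pnatr_eq0 -lt0n fact_gt0.
have e1 : cbin m.*2 * oddfact m = (- 1) ^+ m * cbin m * P.
  have := cbin_fact m.*2; rewrite fact_double oddfact_double -/P => h.
  have h4 : (- 2) ^+ m.*2 = 2 ^+ m * 2 ^+ m :> int.
    by rewrite -addnn exprD -!exprMn; congr (_ ^+ _).
  apply: (mulfI (x := 2 ^+ m * (m`!)%:R)); first by rewrite mulf_neq0 // expf_neq0.
  transitivity (cbin m.*2 * (2 ^+ m * (m`!)%:R * oddfact m)); first by ring.
  rewrite h h4.
  transitivity ((- 1) ^+ m * 2 ^+ m * P * (cbin m * (m`!)%:R)); last by ring.
  rewrite cbin_fact.
  transitivity ((- 1) ^+ m * (- 2) ^+ m * 2 ^+ m * P * oddfact m); last by ring.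
  by rewrite -[(- 1) ^+ m * _]exprMn mulN1r opprK; ring.
rewrite expr2 mulrA e1 {1}oddfact_rev.
have -> : \prod_(k < m) ((k.*2.+1)%:R ^+ 2 - (m.*2)%:R ^+ 2)
    = (- 1) ^+ m * (P * \prod_(k < m) ((m.*2)%:R - (k.*2.+1)%:R)) :> int.
  have -> : (- 1) ^+ m = \prod_(k < m) (- 1) :> int by rewrite prodr_const card_ord.
  rewrite /P -!big_split /=.
  by apply: eq_bigr => k _; ring.
by ring.
Qed.

(** First-order expansion in 2 y: modulo 2, each of the j factors contributes 1 to X, since all the
    other factors are odd. *)
Lemma odd_prod_expand (y : int) j : exists X z w : int,
  [/\ \prod_(k < j) ((k.*2.+1)%:R ^+ 2 - 2 * y) = oddfact j ^+ 2 - 2 * y * X,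
      X = j%:R + 2 * z & oddfact j = 1 + 2 * w].
Proof.
elim: j => [|j [X [z [w [eP eX eO]]]]].
  by exists 0, 0, 0; rewrite /oddfact !big_ord0; split; ring.
rewrite big_ord_recr /= eP oddfactS.
have -> : (j.*2.+1)%:R = 1 + 2 * j%:R :> int by rewrite -natrM -natr1 addrC mul2n.
exists (((1 + 2 * j%:R) ^+ 2 - 2 * y) * X + oddfact j ^+ 2).
exists (z + (2 * j%:R + 2 * j%:R ^+ 2 - y) * X + 2 * w + 2 * w ^+ 2).
exists (w + j%:R + 2 * w * j%:R); split; first by ring.
  by rewrite eO eX -natr1; ring.
by rewrite eO; ring.
Qed.

Lemma RR_dlog1_even m : (2 < m)%N -> odd m -> exists y, dlog (RR (1 : int)) m = 2 * y.
Proof.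
case: m => [|[|m]] // _ odd_m; have := cbin_rec m.+1.
rewrite !cbinS; set a := dlog _ m.+2; set b := dlog _ _.
have [k ->] : exists k, m = k.*2.+1 by exists m./2; lia.
(* The recurrence reads (2k + 3) a = -(8k + 10) b; the witness comes from a = (2k + 3) a - 2 (k + 1)
   a. *)
move=> h; exists (- (4 * k%:R + 5) * b - (k%:R + 1) * a); move: h.
have -> : (k.*2.+3)%:R = 2 * k%:R + 3 :> int.
  by rewrite -natrM -natrD; congr _%:R; lia.
have -> : (k.*2.+2.*2.*2.+2)%:R = 8 * k%:R + 10 :> int.
  by rewrite -natrM -natrD; congr _%:R; lia.
by lra.
Qed.

(** For s = 0 the defect is a_n alone. Otherwise n = 2m, and [cbin_double] shows that a_n - a_m,
    times an odd square, is -4 m^2 X a_m. Here 4 m^2 already accounts for 2^(2s), so one more factor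
    2 is needed. *)
Lemma RR_defect1_even s r (B : int) : odd r -> (2 < 2 ^ s * r)%N ->
  RR_defect 1 (2 ^ s * r) = 2 ^+ s * 2 ^+ s * B -> exists y, B = 2 * y.
Proof.
move=> odd_r; case: s => [|s] n_gt2 eB.
  rewrite mul1n in n_gt2 eB; have [y ey] := RR_dlog1_even n_gt2 odd_r.
  exists y; rewrite -ey -[B]mul1r -[1]mulr1 -eB.
  by rewrite /RR_defect fps_powE dvdn2 odd_r subr0.
pose m := (2 ^ s * r)%N.
have em : (2 ^ s.+1 * r = m.*2)%N by rewrite expnS -mulnA mul2n.
rewrite em in n_gt2 eB; have m_gt1 : (1 < m)%N by lia.
pose a : fps int := dlog (RR 1).
rewrite /RR_defect expr1n fps_powE -muln2 dvdn_mull // mulnK // muln2 -/a in eB.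
have [X [z [w [eP eX eO]]]] := odd_prod_expand (2 * m%:R ^+ 2) m.
have cbinE k : (0 < k)%N -> cbin k = - (2 * a k) by case: k => // k _; apply: cbinS.
have e : (a m.*2 - a m) * oddfact m ^+ 2 = - (4 * m%:R ^+ 2) * (X * a m).
  have := cbin_double m; rewrite !cbinE; try lia.
  rewrite (eq_bigr (fun k : 'I_m => (k.*2.+1)%:R ^+ 2 - 2 * (2 * m%:R ^+ 2))) => [|k _].
    by rewrite eP => h; apply: (mulfI (x := - 2)) => //; move: h; lra.
  by rewrite -[m.*2]mul2n natrM; ring.
(* If m is odd, a_m is even; if m is even, X is even because X = m modulo 2. *)
have [y ey] : exists y, X * a m = 2 * y.
  have [odd_m|even_m] := boolP (odd m).
    have [|y ->] := @RR_dlog1_even m _ odd_m; first by lia.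
    by exists (X * y); ring.
  have em2 : m%:R = 2 * (m./2)%:R :> int by rewrite -natrM; congr _%:R; lia.
  by exists ((m./2%:R + z) * a m); rewrite eX em2; ring.
have /eqP : 2 ^+ s * 2 ^+ s * (4 * (B * oddfact m ^+ 2 + 2 * (r%:R ^+ 2 * y))) = 0.
  have -> : 2 ^+ s * 2 ^+ s * (4 * (B * oddfact m ^+ 2 + 2 * (r%:R ^+ 2 * y)))
     = 2 ^+ s.+1 * 2 ^+ s.+1 * B * oddfact m ^+ 2
       + 4 * (2 ^+ s * r%:R) ^+ 2 * (2 * y).
    by rewrite [2 ^+ s.+1]exprS; ring.
  rewrite -eB e ey /m natrM natrX.
  by ring.
rewrite !mulf_eq0 !expf_eq0 /= !andbF /= => /eqP h.
(* With [oddfact m] = 1 + 2 w, its square is 1 + 4 (w + w^2); solve B (1 + 2 w)^2 = -2 r^2 y for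
   B. *)
exists (- (r%:R ^+ 2 * y) - 2 * (w + w ^+ 2) * B); move: h; rewrite eO => h.
transitivity (B * (1 + 2 * w) ^+ 2 + 2 * (r%:R ^+ 2 * y)
   + 2 * (- (r%:R ^+ 2 * y) - 2 * (w + w ^+ 2) * B)); first by ring.
by rewrite h add0r.
Qed.

(** * The formal logarithm and its derivative in characteristic 0 *)

Section Logarithm.
Variable K : fieldType.
Hypothesis charK : [pchar K] =i pred0.

Lemma fps_log_dlog (f : fps K) n : f 0%N = 1 -> n%:R * fps_log f n = dlog f n.
Proof.
move=> f0; pose u := f - 1; pose S := \sum_(i < n) (- u) ^+ i.
have u0 : u 0%N = 0 by rewrite fpsB f0 fps1 subrr.
have thu : theta u = theta f.
  have -> : f = u + 1 by rewrite subrK.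
  by rewrite (thetaD u 1) theta1 addr0.
have fS : f * S = 1 - (- u) ^+ n.
  have := subrX1 (- u) n; rewrite -/S => h.
  by rewrite -[RHS]opprB h /u; ring.
have eL : dlog f = S * theta f + (- u) ^+ n * dlog f.
  apply: (fps_mulI f0); have -> : f * (S * theta f + (- u) ^+ n * dlog f)
    = f * S * theta f + (- u) ^+ n * (f * dlog f) by ring.
  by rewrite fS dlogE //; ring.
have nu0 : (- u) 0%N = 0 by rewrite fpsN u0 oppr0.
(* S is 1/f up to a multiple of (f - 1)^n. Since [dlog f] has no constant term, the error only
   starts at z^(n+1). *)
have -> : dlog f n = (S * theta f) n.
  rewrite {1}eL fpsD [X in _ + X](_ : _ = 0) ?addr0 //.
  rewrite (fps_decomp (dlog f)) dlog0 scale0r add0r.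
  rewrite mulrCA fps_mulX; case: n {S fS eL} => // n.
  by rewrite fps_order_expr.
have -> : fps_log f n = \sum_(k < n) (- 1) ^+ k / k.+1%:R * (u ^+ k.+1) n.
  by rewrite /= big_add1 big_mkord.
rewrite /S mulr_suml fps_sum mulr_sumr -thu; apply: eq_bigr => k _.
rewrite mulrCA.
have -> : n%:R * (u ^+ k.+1) n = theta (u ^+ k.+1) n by [].
rewrite thetaX fpsMn -(mulr_natl ((u ^+ k * theta u : fps K) n)).
have kn0 : k.+1%:R != 0 :> K by rewrite ((pcharf0P K).1 charK).
have -> : (- u) ^+ k = (- 1) ^+ k *: u ^+ k.
  by rewrite -scaleN1r exprZn.
by rewrite -scalerAl fpsZ -mulrA mulKf.
Qed.

End Logarithm.

(** * From the coefficients of h to the continued fraction *)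

Section CoefficientsOfH.
Variable Q : rat.
Hypothesis Q_neq0 : Q != 0.
Hypothesis Q_exp : forall n, (0 < n)%N -> Q ^+ n != 1.
Let t := Q^-1.
Let F := f_series Q.

Lemma f_series0 : F 0%N = 1.
Proof. by rewrite /= /qpoch big_geq // expr0 bin0n expr0 mulr1 divr1. Qed.

Lemma qpoch_neq0 n : qpoch Q n != 0.
Proof.
rewrite /qpoch big_add1 big_mkord; apply/prodf_neq0 => i _.
by rewrite subr_eq0 eq_sym Q_exp.
Qed.

Lemma f_series_rec n : F n.+1 * (1 - t ^+ n.+1) = t * (t ^+ 2) ^+ n * F n.
Proof.
rewrite /= /qpoch big_nat_recr //= -/(qpoch Q n) binS bin1 exprD /t !exprVn.
rewrite -exprM mulnC exprM !exprS expr0 mulr1.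
have := qpoch_neq0 n; move: (qpoch Q n) => P P0.
have c0 : Q ^+ 'C(n, 2) != 0 by rewrite expf_neq0.
have x0 : Q ^+ n != 0 by rewrite expf_neq0.
have y0 : 1 - Q * Q ^+ n != 0 by rewrite -exprS subr_eq0 eq_sym Q_exp.
move: (Q ^+ 'C(n, 2)) (Q ^+ n) c0 x0 y0 => c x c0 x0 y0.
by field; rewrite ?P0 ?c0 ?x0 ?y0 ?Q_neq0.
Qed.

Lemma f_series_functional : F = dil t F + t *: fpsX * dil (t ^+ 2) F.
Proof.
apply: fpsP => n; rewrite fpsD -scalerAl fpsZ fps_mulX !dilE.
case: n => [|n]; first by rewrite expr0 mul1r mulr0 addr0.
by rewrite dilE mulrA -f_series_rec; ring.
Qed.

Lemma h_series_RR n : n%:R * h_series Q n * (1 - t ^+ n) = dlog (RR t) n.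
Proof.
have F0 := f_series0; have sF0 : dil t F 0%N = 1 by rewrite dil0.
have ssF0 : dil (t ^+ 2) F 0%N = 1 by rewrite dil0.
pose r := F * fps_inv (dil t F).
have r0 : r 0%N = 1.
  have /(congr1 (fun a : fps rat => a 0%N)) := fps_invE sF0.
  by rewrite !fpsM0 sF0 F0.
have Fr : F = r * dil t F by rewrite /r -mulrA [_ * dil t F]mulrC fps_invE // mulr1.
have sFr : dil t F = dil t r * dil (t ^+ 2) F.
  by rewrite {1}Fr rmorphM /= dil_dil.
have er : r = RR t.
  (* The functional equation of F divided by F(t^2 z) is that of [RR t] for the quotient r = F(z) /
     F(t z). *)
  apply: RR_uniq => //; apply: (fps_mulI ssF0).
  transitivity (r * (dil t r * dil (t ^+ 2) F)); first by ring.
  rewrite -sFr -Fr [LHS]f_series_functional {1}sFr; ring.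
have := congr1 (@dlog rat) Fr; rewrite dlogM // dlog_dil // er => e.
have := congr1 (fun a : fps rat => a n) e.
rewrite fpsD dilE -(fps_log_dlog (Num.Theory.pchar_num _) _ F0) -/(h_series Q) => h.
by rewrite mulrBr mulr1 {1}h; ring.
Qed.

End CoefficientsOfH.

(** For n = 2m the factor 1/2 turns n into m, the index in h(Q^2), and (Q^2)^(-m) = Q^(-n); both
    terms thus share the factor 1 - Q^(-n). *)
Lemma RR_defect_h (Q : rat) n : Q != 0 ->
  (forall n, (0 < n)%N -> Q ^+ n != 1) ->
  n%:R * (h_series Q n - 2^-1 * fps_subst_pow 2 (h_series (Q ^+ 2)) n)
    * (1 - Q^-1 ^+ n) = RR_defect Q^-1 n.
Proof.
move=> Q0 Qx; rewrite [_%:R * _]mulrBr mulrBl h_series_RR // /RR_defect !fps_powE.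
congr (_ - _); case: ifP => [/dvdnP[m ->]|_]; last by rewrite !mulr0 mul0r.
rewrite mulnK // [Q^-1 ^+ 2]exprVn -h_series_RR; first last.
- by move=> k k_gt0; rewrite -exprM Qx // muln_gt0.
- by rewrite expf_neq0.
rewrite natrM exprVn [(m * 2)%N]mulnC exprM exprVn.
by field; rewrite !expf_neq0.
Qed.

(** Read off from R = 1 + t z - t^3 z^2 + ...; these values yield the explicit terms z - z^2/q. *)
Lemma RR_dlog12 (A : comNzRingType) (t : A) :
  dlog (RR t) 1%N = t /\ dlog (RR t) 2%N = - (t ^+ 3 *+ 2) - t ^+ 2.
Proof.
have T0 : RR_tail t 0%N = t.
  by rewrite RR_tailE fpsD fpsZ fps1 mulr1 fps_mulX addr0.
have T1 : RR_tail t 1%N = - t ^+ 3.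
  rewrite RR_tailE fpsD fpsZ fps1 mulr0 add0r fps_mulX !fpsM0 dilE fpsN fpsZ fps1.
  by rewrite T0 /=; ring.
have R1 : RR t 1%N = t by rewrite RR_S T0.
have R2 : RR t 2%N = - t ^+ 3 by rewrite RR_S T1.
have e := dlogE (RR0 t).
have : RR t 0%N * dlog (RR t) 1%N + RR t 1%N * dlog (RR t) 0%N = 1%:R * RR t 1%N.
  by rewrite -thetaE -e fpsM !big_ord_recl big_ord0 addr0.
have : RR t 0%N * dlog (RR t) 2%N + (RR t 1%N * dlog (RR t) 1%N
    + RR t 2%N * dlog (RR t) 0%N) = 2%:R * RR t 2%N.
  by rewrite -thetaE -e fpsM !big_ord_recl big_ord0 addr0.
rewrite RR0 R1 R2 dlog0 !mul1r !mulr0 !addr0 => e2 e1; split=> //.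
by rewrite -[LHS](addrK (t * dlog (RR t) 1%N)) e2 e1; ring.
Qed.

Lemma RR_defect12 (A : comNzRingType) (t : A) :
  RR_defect t 1 = t /\ RR_defect t 2 = - ((t ^+ 3 + t ^+ 2) *+ 2).
Proof.
have [e1 e2] := RR_dlog12 t; have [e3 _] := RR_dlog12 (t ^+ 2).
rewrite /RR_defect !fps_powE; split; first by apply: etrans e1; apply: subr0.
by transitivity (- (t ^+ 3 *+ 2) - t ^+ 2 - t ^+ 2); [congr (_ - _) | ring].
Qed.

(** * Rationals with odd denominator: the localization of Z at 2 *)

Definition integral2 (x : rat) :=
  exists (a : int) (b : nat), odd b /\ x * b%:R = a%:~R.

Lemma integral2D x y : integral2 x -> integral2 y -> integral2 (x + y).
Proof.
move=> [a [b [ob e]]] [c [d [od f]]]; exists (a * d%:R + c * b%:R), (b * d)%N.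
by rewrite oddM ob od intrD !intrM !rmorph_nat -e -f natrM; split=> //; ring.
Qed.

Lemma integral2M x y : integral2 x -> integral2 y -> integral2 (x * y).
Proof.
move=> [a [b [ob e]]] [c [d [od f]]]; exists (a * c), (b * d)%N.
by rewrite oddM ob od intrM -e -f natrM; split=> //; ring.
Qed.

Lemma integral2_int (a : int) : integral2 a%:~R.
Proof. by exists a, 1%N; rewrite mulr1. Qed.

Lemma integral2_inv (b : nat) : odd b -> integral2 b%:R^-1.
Proof.
move=> ob; exists 1, b; split=> //; rewrite mulVf // Num.Theory.pnatr_eq0.
by case: b ob.
Qed.

(** 1/q = 1 modulo 2 in this ring, and polynomials with integer coefficients preserve
    congruences. *)
Lemma int_eval_mod2 (q : nat) (B : {poly int}) : odd q ->
  exists2 u, integral2 u & int_eval q%:R^-1 B = (int_eval 1 B)%:~R + 2 * u.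
Proof.
move=> odd_q; set t := q%:R^-1; have t_int : integral2 t := integral2_inv odd_q.
elim/poly_ind: B => [|B c [u u_int eu]].
  by exists 0; [apply: (integral2_int 0) | rewrite !rmorph0 mulr0 addr0].
have evC (K : comNzRingType) (x : K) : int_eval x c%:P = c%:~R.
  by rewrite /= /horner_eval map_polyC hornerC.
have et : t = 1 + 2 * ((- (q./2)%:Z)%:~R * t).
  have q0 : q%:R != 0 :> rat by rewrite Num.Theory.pnatr_eq0 -lt0n odd_gt0.
  have -> : (- (q./2)%:Z)%:~R = - (q./2)%:R :> rat by rewrite rmorphN.
  have : q%:R = 1 + 2 * (q./2)%:R :> rat.
    by rewrite -[in LHS](odd_double_half q) odd_q natrD -mul2n natrM.
  by rewrite /t => e; apply: (mulfI q0); rewrite mulrDr mulfV // e; field; rewrite -e.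
exists (u * t + (int_eval 1 B)%:~R * ((- (q./2)%:Z)%:~R * t)).
  by do ?[apply: integral2D | apply: integral2M | apply: integral2_int].
rewrite !rmorphD !rmorphM !int_evalX !evC -/t mulr1 eu mulrDl {1}et intz; ring.
Qed.

(** The cleared sum consists of k powers of the odd number Q. *)
Lemma qint_odd (Q k : nat) : odd Q -> exists o : nat,
  odd o = odd k /\ qint (Q%:R^-1 : rat) k * Q%:R ^+ k = o%:R.
Proof.
move=> odd_Q; have Q0 : Q%:R != 0 :> rat.
  by rewrite Num.Theory.pnatr_eq0 -lt0n odd_gt0.
elim: k => [|k [o [odd_o eo]]]; first by exists 0%N; rewrite /qint big_ord0 mul0r.
exists (o * Q + Q)%N; split; first by rewrite oddD oddM odd_Q odd_o andbT addbT.
rewrite /qint big_ord_recr /= -/(qint _ k) mulrDl exprSr mulrA eo natrD natrM.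
by rewrite mulrA -exprMn mulVf // expr1n mul1r.
Qed.

Lemma qint_mul (A : comNzRingType) (x : A) m k :
  1 - x ^+ (m * k) = (1 - x) * qint x m * qint (x ^+ m) k.
Proof.
have qE (y : A) l : 1 - y ^+ l = (1 - y) * qint y l.
  by rewrite -opprB subrX1 -mulNr opprB.
by rewrite -qE exprM qE.
Qed.

Lemma natr_exp_neq1 (q k : nat) : (1 < q)%N -> (0 < k)%N -> q%:R ^+ k != 1 :> rat.
Proof.
case: k => // k q_gt1 _; rewrite -natrX Num.Theory.pnatr_eq1.
by rewrite -[X in _ != X](exp1n k.+1) eqn_exp2r // gtn_eqF.
Qed.

Lemma one_sub_inv_exp_neq0 (q k : nat) : (1 < q)%N -> (0 < k)%N ->
  1 - q%:R^-1 ^+ k != 0 :> rat.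
Proof.
by move=> q_gt1 k_gt0; rewrite subr_eq0 eq_sym exprVn invr_eq1 natr_exp_neq1.
Qed.

Lemma h_defect_coef (q n : nat) : odd q -> (1 < q)%N -> (2 < n)%N ->
  exists (a : int) (b : nat), odd b /\
   ((q%:R - 1) * (h_series q%:R n
      - 2^-1 * fps_subst_pow 2 (h_series (q%:R ^+ 2)) n)) * b%:R = (2 * a)%:~R.
Proof.
move=> odd_q q_gt1 n_gt2; set c := _ * (_ - _).
have q_gt0 : (0 < q)%N by apply: ltnW.
have q0 : q%:R != 0 :> rat by rewrite Num.Theory.pnatr_eq0 -lt0n.
have tX k : (0 < k)%N -> 1 - q%:R^-1 ^+ k != 0 :> rat.
  exact: one_sub_inv_exp_neq0.
have := RR_defect_h n q0 (fun k => natr_exp_neq1 q_gt1); set t := q%:R^-1 in tX *.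
have n_gt0 : (0 < n)%N by apply: ltn_trans n_gt2.
have [r] := pfactor_coprime (isT : prime 2) n_gt0.
rewrite coprime2n mulnC; set s := logn 2 n => odd_r en.
have [B eB] := @RR_defect_factor s n (pfactor_dvdnn 2 n).
have evB (K : comNzRingType) (x : K) :
    RR_defect x n = 2 ^+ s * qint x (2 ^ s) * int_eval x B.
  rewrite -[in LHS](int_evalX x) -RR_defect_map eB !rmorphM rmorphXn rmorph_nat.
  by rewrite qint_eval.
have eB1 : RR_defect 1 (2 ^ s * r) = 2 ^+ s * 2 ^+ s * int_eval (1 : int) B.
  rewrite -en evB; congr (_ * _ * _); rewrite /qint (eq_bigr (fun=> 1)) => [|i _].
    by rewrite sumr_const card_ord natrX.
  by rewrite expr1n.
have [|y ey] := RR_defect1_even odd_r _ eB1; first by rewrite -en.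
have [u [a [b [odd_b ub]]] eu] := int_eval_mod2 B odd_q.
have odd_Q : odd (q ^ (2 ^ s)) by rewrite oddX odd_q orbT.
have [o [odd_o eo]] := qint_odd r odd_Q.
have et : (q ^ 2 ^ s)%:R^-1 = t ^+ (2 ^ s) :> rat by rewrite natrX exprVn.
rewrite et in eo; set Q := ((q ^ 2 ^ s)%:R : rat) in eo.
have eT : 1 - t ^+ n = (1 - t) * qint t (2 ^ s) * qint (t ^+ (2 ^ s)) r.
  by rewrite [in LHS]en qint_mul.
have eN : n%:R = 2 ^+ s * r%:R :> rat by rewrite [in LHS]en natrM natrX.
have := tX n n_gt0; rewrite eT !mulf_eq0 !negb_or => /andP[/andP[_ D_neq0] _].
rewrite evB eN eu ey intrM.
set H := h_series _ _ - _ in c *; set D := qint t _ in D_neq0 *.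
set E := qint _ r in eo *; set Y : rat := y%:~R => eh.
(* Cancelling 2^s D in [eh] leaves r E c = q B(t), where B(t) = 2 (y + u), u b = a and E Q^r = o.
   Clearing denominators gives both witnesses. *)
exists (q%:Z * ((q ^ (2 ^ s)) ^ r)%:Z * (y * b%:Z + a)), (r * o * b)%N.
split; first by rewrite !oddM odd_r odd_o odd_r odd_b.
rewrite [RHS](_ : _ = 2 * (q%:R * Q ^+ r * (Y * b%:R + a%:~R))); last first.
  by rewrite !(intrM, intrD) -natrX.
have -> : c = q%:R * (1 - t) * H by rewrite /c; congr (_ * _); rewrite mulrBr mulr1 mulfV.
apply: (mulfI (x := 2 ^+ s * D)); first by rewrite mulf_neq0 ?expf_neq0.
rewrite !natrM -eo -ub.
transitivity (q%:R * Q ^+ r * b%:R * (2 ^+ s * r%:R * H * ((1 - t) * D * E))).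
  by ring.
by rewrite eh; ring.
Qed.

(** * Passage to the 2-adic integers *)

Lemma ratr_mul_nat (K : fieldType) (x : rat) (a : int) (b : nat) :
  [pchar K] =i pred0 -> x * b%:R = a%:~R -> ratr x * b%:R = a%:~R :> K.
Proof.
move=> charK e; have d_neq0 : (denq x)%:~R != 0 :> K.
  by have := denq_gt0 x; case: (denq x) => // d; rewrite ((pcharf0P K).1 charK); lia.
have eZ : numq x * b%:Z = a * denq x.
  apply/eqP; rewrite -(eqr_int rat) !intrM -e -[in x * _](divq_num_den x).
  apply/eqP; have dq0 : (denq x)%:~R != 0 :> rat by rewrite intr_eq0 denq_neq0.
  by rewrite mulrAC divfK.
apply: (mulIf d_neq0); rewrite /ratr mulrAC divfK // -intrM -eZ intrM.
by [].
Qed.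

Lemma Z2_natE (m k : nat) : (m%:R : Z2) k = (m %% 2 ^ k)%N.
Proof.
have Z2_addE (x y : Z2) : (x + y) k = ((x k + y k) %% 2 ^ k)%N by [].
elim: m => [//|m IHm]; rewrite -natr1 Z2_addE IHm.
by rewrite [(1 : Z2) k](_ : _ = 1 %% 2 ^ k)%N // modnDm addn1.
Qed.

Lemma Q2_char0 : [pchar Q2] =i pred0.
Proof.
apply/pcharf0P => m; rewrite -(rmorph_nat (@tofrac Z2)) tofrac_eq0.
apply/eqP/eqP => [/(congr1 (fun x : Z2 => x m))|-> //].
have Z2_0E : (0 : Z2) m = (0 %% 2 ^ m)%N by [].
by rewrite Z2_natE Z2_0E mod0n modn_small // ltn_expl.
Qed.

Lemma odd_exp2n_mod b k : odd b -> (b ^ (2 ^ k) = 1 %[mod 2 ^ k])%N.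
Proof.
case: k => [|k] odd_b; first by rewrite !modn1.
have cop : coprime b (2 ^ k.+1) by rewrite coprimeXr // coprimen2.
have := Euler_exp_totient cop; rewrite totient_pfactor //= mul1n => h.
have -> : (b ^ 2 ^ k.+1 = (b ^ 2 ^ k) ^ 2)%N by rewrite -expnM expnSr.
by rewrite -modnXm h modnXm exp1n.
Qed.

(** By [odd_exp2n_mod], b^(2^k - 1) inverts b modulo 2^k; these residues form the 2-adic inverse of
    b. *)
Lemma Z2_inv_coherent b k : odd b ->
  (b ^ (2 ^ k).-1 %% 2 ^ k = b ^ (2 ^ k.+1).-1 %% 2 ^ k.+1 %% 2 ^ k)%N.
Proof.
move=> odd_b; apply: modn2_coherent.
have -> : ((2 ^ k.+1).-1 = 2 ^ k + (2 ^ k).-1)%N.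
  by have := expn_gt0 2 k; rewrite expnS; lia.
by rewrite expnD -modnMml odd_exp2n_mod // modnMml mul1n.
Qed.

Lemma Z2_odd_unit b : odd b -> exists y : Z2, y * b%:R = 1.
Proof.
move=> odd_b; exists (MkZ2 (fun k => Z2_inv_coherent k odd_b)); apply: Z2P => k.
have Z2_mulE (x y : Z2) : (x * y) k = ((x k * y k) %% 2 ^ k)%N by [].
rewrite Z2_mulE Z2_natE modnMm -expnSr prednK ?expn_gt0 //.
exact: odd_exp2n_mod.
Qed.

Theorem theorem2p9 (q : nat) (hq : prime_power q) (hodd : odd q) :
  exists g : fps Z2,
    fps_map (ratr : rat -> Q2)
      ((q%:R - 1) *: (h_series q%:R
                      - 2^-1 *: fps_subst_pow 2 (h_series (q%:R ^+ 2))))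
    = fpsX - (q%:R)^-1 *: fpsX ^+ 2
      + 2 *: (fpsX ^+ 3 * fps_map Z2_to_Q2 g).
Proof.
have q_gt1 : (1 < q)%N.
  case: hq => p [k [p_prime k_gt0 ->]].
  by rewrite -{1}(exp1n k) ltn_exp2r // prime_gt1.
have Q2_nat m : (m%:R == 0 :> Q2) = (m == 0%N) := (pcharf0P _).1 Q2_char0 m.
have odd_neq0 b : odd b -> b%:R != 0 :> Q2.
  by move=> /odd_gt0; rewrite Q2_nat lt0n.
pose c n : rat := (q%:R - 1) * (h_series q%:R n
  - 2^-1 * fps_subst_pow 2 (h_series (q%:R ^+ 2)) n).
have [g gE] : exists g : nat -> Z2, forall n, ratr (c n.+3) = 2 * Z2_to_Q2 (g n) :> Q2.
  suff /choice[g gE] : forall n, exists x : Z2,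
    ratr (c n.+3) = 2 * Z2_to_Q2 x :> Q2 by exists g.
  move=> n; have [a [b [odd_b e]]] := @h_defect_coef q n.+3 hodd q_gt1 isT.
  (* The rational coefficient is 2 a / b with b odd, so a times the 2-adic inverse of b is the
     required coefficient of g. *)
  have [y yb] := Z2_odd_unit odd_b; exists (a%:~R * y).
  apply: (mulIf (odd_neq0 b odd_b)); rewrite (ratr_mul_nat Q2_char0 e).
  have toQ2M (u v : Z2) : Z2_to_Q2 (u * v) = Z2_to_Q2 u * Z2_to_Q2 v.
    exact: rmorphM.
  have toQ2_nat m : Z2_to_Q2 m%:R = m%:R by exact: rmorph_nat.
  have toQ2_int (m : int) : Z2_to_Q2 m%:~R = m%:~R by exact: rmorph_int.
  by rewrite -mulrA -(toQ2_nat b) -toQ2M -mulrA yb mulr1 toQ2_int intrM.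
exists (Fps g); apply: fpsP => n.
transitivity (ratr (c n) : Q2); first by [].
rewrite fpsD fpsB !fpsZ fps_mulXn fps_Xn.
have [n_lt3|n_ge3] := ltnP n 3; last first.
  case: n n_ge3 => [|[|[|n]]] // _.
  by rewrite !mulr0 subrr add0r subSS subSS subSS subn0 gE.
rewrite mulr0 addr0.
have q_gt0 : (0 < q)%N by apply: ltnW.
have q0 : q%:R != 0 :> rat by rewrite Num.Theory.pnatr_eq0 -lt0n.
have tX k : (0 < k)%N -> 1 - q%:R^-1 ^+ k != 0 :> rat.
  exact: one_sub_inv_exp_neq0.
have := RR_defect_h n q0 (fun k => natr_exp_neq1 q_gt1).
have [r1 r2] := RR_defect12 (q%:R^-1 : rat).
set H := _ - _; have ec : c n = q%:R * (1 - q%:R^-1) * H.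
  by rewrite /c; congr (_ * _); rewrite mulrBr mulr1 mulfV.
(* With t = 1/q and c n = q (1 - t) H: c 0 = 0 as logarithms have no constant term; H (1 - t) is t
   for n = 1 and -t^2 for n = 2, giving 1 and -1/q. *)
case: n n_lt3 @H ec => [|[|[|n]]] // _ H ec.
- have -> : c 0%N = 0.
    have h0 Q : h_series Q 0%N = 0 by rewrite /h_series /= big_geq.
    have c0 (x y : rat) (a b : fps rat) : a 0%N = 0 -> b 0%N = 0 ->
        x * (a 0%N - y * fps_subst_pow 2 b 0%N) = 0.
      by move=> a0 b0; rewrite fps_powE dvdn0 div0n a0 b0 mulr0 subr0 mulr0.
    by apply: c0; apply: h0.
  by move=> _; rewrite /ratr /= mul0r mulr0 subrr.
- rewrite r1 mul1r expr1 => e.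
  have := @ratr_mul_nat Q2 (c 1%N) 1 1 Q2_char0; rewrite !mulr1 => -> //.
    by rewrite mulr0 subr0.
  by rewrite ec -mulrA [_ * H]mulrC e mulfV.
rewrite r2 => e; apply: (mulIf (odd_neq0 q hodd)).
rewrite (@ratr_mul_nat Q2 (c 2%N) (-1) q Q2_char0).
  by rewrite sub0r mulr1 mulNr mulVf ?odd_neq0 // rmorphN.
rewrite ec; set t := q%:R^-1 in e *.
have qt : q%:R * t = 1 by rewrite /t mulfV.
apply: (mulfI (tX 2%N isT)); rewrite -/t.
transitivity (q%:R ^+ 2 * (1 - t) / 2 * (2 * H * (1 - t ^+ 2))); first by field.
rewrite e; transitivity (- ((q%:R * t) ^+ 2 * (1 - t ^+ 2))); first by field.
by rewrite qt; ring.
Qed.
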